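(* Let $n\ge4$ and $m=n-2$. The map $K_n$ and every successive coordinate descent of $K_n$ are stably polynomially left--right inequivalent to any single ordinary weighted lift of the same geometric degree $nm$.
   Context: All varieties are over $\mathbb C$. The geometric degree of a dominant polynomial map between affine spaces of equal dimension is the degree of its function field extension. Definition of $K_n$. For $n\ge 3$ use coordinates $(x,y,z_3,\ldots,z_n)$ on $\mathbb A^n$, put $p=1+xy$, and let $$\Phi_n(T)=(1-yT)^{n-1}(pT-x)+(pT-x)^2\Bigl[ny\bigl(yT+\tfrac12\bigr)+z_3\bigl(pT+\tfrac x2\bigr)+\sum_{j=4}^n z_jT^{j-2}\Bigr].$$ Its coefficient of $T$ equals $1$. Write $\Phi_n(T)=\sum_{j=3}^n C_jT^j+A_2T^2+T-A_0$ and $K_n=(C_3,\ldots,C_n,A_2,A_0):\mathbb A^n\to\mathbb A^n$. Successive coordinate descents. For $n\ge4$ put $\lambda_2=A_2$ and $\lambda_j=C_j$ ($3\le j\le n-2$) (the lower coefficients), $r=C_{n-1}$, $q=C_n$, $b=A_0$. Fix a prefix $\lambda_2,\ldots,\lambda_k$ of the lower coefficients to complex values and keep the remaining lower coefficients and $r,q,b$ free; the descent is the restriction of $K_n$ to the locus in $\mathbb A^n$ where these coefficients take the fixed values. This locus is isomorphic to an affine space $\mathbb A^d$ with $3\le d\le n$, and the descent is a polynomial map $\mathbb A^d\to\mathbb A^d$ whose target coordinates are the free coefficients; it has geometric degree $nm$. Ordinary weighted lift (of geometric degree $nm$): a polynomial map $\mathbb A^3\to\mathbb A^3_{A,B,C}$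 whose source function field is generated over $\mathbb C(A,B,C)$ by one element $w$ with minimal polynomial $\mathcal H(w)-BCw+cAC^2$, where $\mathcal H\in\mathbb C[w]$ has degree $nm$ and $c\in\mathbb C^*$. Stable left--right equivalence: two polynomial maps are stably (polynomially) left--right equivalent if, after adjoining enough identity coordinates to each (replacing $F$ by $F\times\mathrm{id}_{\mathbb A^i}$ and $G$ by $G\times\mathrm{id}_{\mathbb A^j}$), polynomial automorphisms of source and target identify them. *)

(* Defs.v *)
From HB Require Import structures.
From mathcomp Require Import all_boot all_order all_algebra.
From mathcomp Require Import mpoly.
From mathcomp Require Import complex.
From mathcomp Require Import reals.

Set Implicit Arguments.
Unset Strict Implicit.
Unset Printing Implicit Defensive.

Import GRing.Theory.
Local Open Scope ring_scope.

(** A polynomial map A^a -> A^b over K is the b-tuple of its components. *)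
Definition polymap (K : fieldType) (a b : nat) := b.-tuple {mpoly K[a]}.

Definition pm_id (K : fieldType) (a : nat) : polymap K a a :=
  [tuple 'X_i | i < a].

Definition pm_comp (K : fieldType) (a b c : nat)
    (G : polymap K b c) (F : polymap K a b) : polymap K a c :=
  [tuple tnth G i \mPo F | i < c].

Definition pm_eval (K : fieldType) (a b : nat) (F : polymap K a b)
    (v : 'I_a -> K) : 'I_b -> K :=
  fun i => (tnth F i).@[v].

Definition pm_iso (K : fieldType) (a b : nat) (F : polymap K a b) : Prop :=
  exists G : polymap K b a,
    pm_comp G F = pm_id K a /\ pm_comp F G = pm_id K b.

(** F x id : A^(a + s) -> A^(b + s), the added coordinates coming last. *)
Definition pm_stab (K : fieldType) (a b s : nat) (F : polymap K a b) :
    polymap K (a + s) (b + s) :=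
  [tuple match split k with
         | inl i => tnth F i \mPo [tuple 'X_(lshift s l) | l < a]
         | inr j => 'X_(rshift a j)
         end | k < b + s].

(** The numerical equalities make [alpha] and [beta] automorphisms of one affine
    space; writing them as isomorphisms avoids casts between
    [{mpoly K[a + s]}] and [{mpoly K[a' + s']}]. *)
Definition stably_equivalent (K : fieldType) (a b a' b' : nat)
    (F : polymap K a b) (G : polymap K a' b') : Prop :=
  exists s s' : nat,
    [/\ (a + s = a' + s')%N, (b + s = b' + s')%N &
     exists (alpha : polymap K (a + s) (a' + s'))
            (beta : polymap K (b + s) (b' + s')),
       [/\ pm_iso alpha, pm_iso beta &
           pm_comp beta (pm_stab s F) = pm_comp (pm_stab s' G) alpha]].

(** The k-th coordinate function, counted from 0 (junk value 0 if k >= n). *)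
Definition coordX (K : fieldType) (n k : nat) : {mpoly K[n]} :=
  if insub k is Some i then 'X_i else 0.

(** The coordinates (x, y, z_3, ..., z_n) are numbered 0, 1, 2, ..., n - 1. *)
Definition Phi (K : fieldType) (n : nat) : {poly {mpoly K[n]}} :=
  let x := coordX K n 0 in
  let y := coordX K n 1 in
  let z j := coordX K n j.-1 in
  let p := 1 + x * y in
  let L := p *: 'X - x%:P in
  (1 - y *: 'X) ^+ n.-1 * L
  + L ^+ 2 * ((n%:R * y) *: (y *: 'X + ((2^-1 : K)%:MP)%:P)
              + z 3 *: (p *: 'X + ((2^-1 : K) *: x)%:P)
              + \sum_(4 <= j < n.+1) z j *: 'X^(j - 2)).

Definition coefC (K : fieldType) (n j : nat) : {mpoly K[n]} := (Phi K n)`_j.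
Definition coefA2 (K : fieldType) (n : nat) : {mpoly K[n]} := (Phi K n)`_2.
Definition coefA0 (K : fieldType) (n : nat) : {mpoly K[n]} := - (Phi K n)`_0.

(** (C_3, ..., C_n, A_2, A_0), for n >= 3. *)
Definition Kmap (K : fieldType) (n : nat) : polymap K n n :=
  [tuple if (i < n - 2)%N then coefC K n (i + 3)
         else if i == (n - 2)%N :> nat then coefA2 K n
         else coefA0 K n | i < n].

Definition lam (K : fieldType) (n j : nat) : {mpoly K[n]} :=
  if j == 2%N then coefA2 K n else coefC K n j.

(** Only the values v 2, ..., v k are used; the prefix is empty for k = 1. *)
Definition locus (K : fieldType) (n k : nat) (v : nat -> K) (P : 'I_n -> K) :
    Prop :=
  forall j : nat, (2 <= j <= k)%N -> (lam K n j).@[P] = v j.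

(** The n - k + 1 free coefficients, in the order
    (lam_(k+1), ..., lam_(n-2), r, q, b), where r = C_(n-1), q = C_n, b = A_0. *)
Definition free_coefs (K : fieldType) (n k : nat) : polymap K n (n - k).+1 :=
  [tuple if (i < n - k)%N then lam K n (i + k.+1) else coefA0 K n
  | i < (n - k).+1].

(** [phi] is an isomorphism of varieties from A^d onto the closed subset [V] of
    A^n: its inverse is regular on [V], i.e. the restriction of some [psi]. *)
Definition parametrizes (K : fieldType) (n d : nat) (V : ('I_n -> K) -> Prop)
    (phi : polymap K d n) : Prop :=
  (forall t : 'I_d -> K, V (pm_eval phi t)) /\
  exists psi : polymap K n d,
    (forall t : 'I_d -> K, pm_eval psi (pm_eval phi t) =1 t) /\
    (forall P : 'I_n -> K, V P -> pm_eval phi (pm_eval psi P) =1 P).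

(** The restriction of K_n to the locus, read through some isomorphism of the
    locus with A^d, d = n - k + 1. *)
Definition is_descent (K : fieldType) (n k : nat) (v : nat -> K)
    (F : polymap K (n - k).+1 (n - k).+1) : Prop :=
  exists2 phi : polymap K (n - k).+1 n,
    parametrizes (@locus K n k v) phi & F = pm_comp (free_coefs K n k) phi.

Arguments is_descent {K} n k v F.

Notation funfield K a := {fraction {mpoly K[a]}}.

Definition ffconst (K : fieldType) (a : nat) (c : K) : funfield K a :=
  tofrac (c%:MP_[a]).

(** The subfield K(F_1, ..., F_b) of K(A^a). *)
Definition pullback_field (K : fieldType) (a b : nat) (F : polymap K a b)
    (f : funfield K a) : Prop :=
  exists P Q : {mpoly K[b]},
    Q \mPo F != 0 /\ f = tofrac (P \mPo F) / tofrac (Q \mPo F).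

Definition poly_with_coefs_in (L : fieldType) (k : L -> Prop) (P : {poly L}) :
    Prop :=
  forall i : nat, k P`_i.

(** L = k(w). *)
Definition generated_by (L : fieldType) (k : L -> Prop) (w : L) : Prop :=
  forall f : L, exists P Q : {poly L},
    [/\ poly_with_coefs_in k P, poly_with_coefs_in k Q,
        Q.[w] != 0 & f = P.[w] / Q.[w]].

(** P is the minimal polynomial of w over k, up to a unit: the polynomials
    below are not required to be monic. *)
Definition is_min_poly (L : fieldType) (k : L -> Prop) (w : L) (P : {poly L}) :
    Prop :=
  [/\ poly_with_coefs_in k P, P != 0, root P w &
      forall Q : {poly L}, poly_with_coefs_in k Q -> Q != 0 -> root Q w ->
        (size P <= size Q)%N].

(** Ordinary weighted lift of geometric degree N; (A, B, C) are the components
    of G. Algebraic independence of A, B, C (dominance of G) is automatic, since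
    w is algebraic over K(A, B, C) and generates K(A^3). *)
Definition weighted_lift (K : fieldType) (N : nat) (G : polymap K 3 3) : Prop :=
  let A := tofrac (tnth G 0) in
  let B := tofrac (tnth G 1) in
  let C := tofrac (tnth G 2) in
  exists (w : funfield K 3) (H : {poly K}) (c : K),
    [/\ size H = N.+1, c != 0,
        generated_by (pullback_field G) w &
        is_min_poly (pullback_field G) w
          (map_poly (@ffconst K 3) H - (B * C) *: 'X
           + (ffconst 3 c * A * C ^+ 2)%:P)].

(* Main.v *)
Require Import Defs.
From HB Require Import structures.
From mathcomp Require Import all_boot all_order all_algebra.
From mathcomp Require Import polyXY zify ring.
From mathcomp Require Import boolp.
From mathcomp Require Import mpoly.
From mathcomp Require Import complex.
From mathcomp Require Import reals.

(** The two kinds of maps are separated by the intermediate fields of the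
    extension of function fields that they define, a datum that is invariant
    under stable left-right equivalence.

    Let E be the function field of the (stabilized) source and k the subfield
    generated by the components of the map.

    On the side of K_n and its descents, put t = x / p.  The polynomial Phi_n
    has coefficients in k and degree at most n, vanishes at t, and satisfies
    p ^ (n - 2) * Phi_n'(t) = 1, since Phi_n is (1 - y T) ^ (n - 1) (p T - x)
    modulo (p T - x) ^ 2 and 1 - y t = 1 / p.  Conversely x = t p, then
    y = (p - 1) / x, then the z_j are recovered from t and p by dividing Phi_n
    minus its first term by (p T - x) ^ 2.  Hence E is reached from k in two
    steps, k(t) of degree at most n over k and E = k(t)(p) of degree at most
    n - 2 over k(t) ([fiber_coords_mem], [deriv_fiber_poly]).

    On the side of a weighted lift, E = k(w), where w is a root of
    P = H(T) - B C T + c A C ^ 2, of degree N = n (n - 2).  The quotient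
    P / (T - w) equals U(T) - B C with U = (H(T) - H(w)) / (T - w), and it is
    irreducible over E: B C is transcendental over a subfield S that contains w
    and C and satisfies E = S(B C), so that the quotient is linear in a
    transcendental element ([irreducible_sub_transcendental]).  In Galois terms
    the extension is doubly transitive, hence primitive.  Concretely, a
    nonzero polynomial Q over an intermediate field L, of degree less than N and
    with Q(w) = 0, has with P a greatest common divisor over L that can only be
    T - w, so w belongs to L ([primitive_root_dichotomy]).

    These two descriptions are incompatible when both degrees n and n - 2 are
    less than N ([no_proper_tower]): w has degree at most n - 2 over k(t), so it
    lies in k(t); it then has degree at most n over k, so it lies in k.  But w
    is not in k: otherwise E would be generated by A, B, C and the coordinates
    added by stabilization, A would be transcendental over the others, and P,
    which is linear in A, would be irreducible over E while having the root w
    there ([weighted_poly_primitive]).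

    The transcendence statements replace a theory of transcendence degree by
    derivations: d - 1 elements of a field of rational functions in d variables
    are killed by a nonzero derivation D ([exists_derivation]), and in
    characteristic zero an element b with D b <> 0 is transcendental over the
    constants of D ([transcendental_over_constants]). *)

Set Implicit Arguments.
Unset Strict Implicit.
Unset Printing Implicit Defensive.

Import GRing.Theory.
Local Open Scope ring_scope.

(** * Subfields and simple extensions *)

Section SubfieldType.
Variables (E : fieldType) (S : divringClosed E).

(** Making a subfield given by a predicate into a type gives access to linear
    algebra and to polynomial gcds over it. *)
Record subfield_type := SubfieldElt { incl_val : E; _ : incl_val \in S }.
HB.instance Definition _ := [isSub for incl_val].
HB.instance Definition _ := [Choice of subfield_type by <:].
HB.instance Definition _ := [SubChoice_isSubComUnitRing of subfield_type by <:].
HB.instance Definition _ :=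
  [SubComUnitRing_isSubIntegralDomain of subfield_type by <:].
HB.instance Definition _ := [SubIntegralDomain_isSubField of subfield_type by <:].

Definition incl : {rmorphism subfield_type -> E} := val.

Arguments incl : simpl never.

Lemma mem_incl u : incl u \in S.
Proof. exact: valP. Qed.

Lemma map_inclP (P : {poly E}) :
  reflect (exists Q, P = map_poly incl Q) (P \is a polyOver S).
Proof.
apply: (iffP idP) => [/polyOverP SP|[Q ->]]; last first.
  by apply/polyOverP => i; rewrite coef_map mem_incl.
exists (\poly_(i < size P) insubd 0 P`_i); apply/polyP => i.
rewrite coef_map coef_poly; case: ltnP => [_|lePi].
  by rewrite /incl /= insubdK.
by rewrite nth_default ?rmorph0.
Qed.

Lemma gcdp_polyOver (P Q : {poly E}) :
  P \is a polyOver S -> Q \is a polyOver S -> gcdp P Q \is a polyOver S.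
Proof.
by move=> /map_inclP[P' ->] /map_inclP[Q' ->]; rewrite -gcdp_map; apply/map_inclP; eexists.
Qed.
End SubfieldType.

Lemma divp_polyOver (E : fieldType) (S : divringClosed E) (P Q : {poly E}) :
  P \is a polyOver S -> Q \is a polyOver S -> P %/ Q \is a polyOver S.
Proof.
by move=> /map_inclP[P' ->] /map_inclP[Q' ->]; rewrite -map_divp; apply/map_inclP; eexists.
Qed.

Section Adjunction.
Variables (E : fieldType) (S : divringClosed E) (e : E).

Definition adjoin : {pred E} := fun u => `[< exists P Q : {poly E},
  [/\ P \is a polyOver S, Q \is a polyOver S, Q.[e] != 0 & u = P.[e] / Q.[e]] >].

Lemma adjoinP u : reflect (exists P Q : {poly E},
  [/\ P \is a polyOver S, Q \is a polyOver S, Q.[e] != 0 & u = P.[e] / Q.[e]])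
  (u \in adjoin).
Proof. exact: asboolP. Qed.

Lemma mem_adjoin_base u : u \in S -> u \in adjoin.
Proof.
move=> Su; apply/adjoinP; exists u%:P, 1.
by rewrite polyOverC Su rpred1 !hornerE oner_neq0 divr1.
Qed.

Lemma mem_adjoin_gen : e \in adjoin.
Proof.
apply/adjoinP; exists 'X, 1.
by rewrite polyOverX rpred1 !hornerE oner_neq0 divr1.
Qed.

Lemma adjoin_divring_closed : divring_closed adjoin.
Proof.
split=> [|u v /adjoinP[P [Q [SP SQ Q0 ->]]] /adjoinP[P' [Q' [SP' SQ' Q'0 ->]]]
  |u v /adjoinP[P [Q [SP SQ Q0 ->]]] /adjoinP[P' [Q' [SP' SQ' Q'0 ->]]]].
- by apply/mem_adjoin_base/rpred1.
- apply/adjoinP; exists (P * Q' - P' * Q), (Q * Q').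
  rewrite rpredB ?rpredM ?rpredM //; split=> //; rewrite !hornerE ?mulf_neq0 //.
  by rewrite -mulNr addf_div // mulNr.
- have [P'0|P'0] := eqVneq P'.[e] 0.
    by rewrite P'0 mul0r invr0 mulr0; apply/mem_adjoin_base/rpred0.
  apply/adjoinP; exists (P * Q'), (Q * P').
  rewrite !rpredM //; split=> //; rewrite !hornerE ?mulf_neq0 //.
  by rewrite invf_div mulf_div.
Qed.

HB.instance Definition _ :=
  GRing.isDivringClosed.Build E adjoin adjoin_divring_closed.
End Adjunction.

(** Write u = P(e) / Q(e).  The d + 1 polynomials P^i Q^(d - i) have remainders
    modulo f in a space of dimension d, so they satisfy a linear relation over S;
    evaluating it at e and dividing by Q(e)^d gives an equation for u.  Clearing
    the denominator in this way avoids proving that S[e] is a field. *)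
Lemma adjoin_degree_bound (E : fieldType) (S : divringClosed E) (e u : E)
    (f : {poly E}) (d : nat) :
  f \is a polyOver S -> f != 0 -> root f e -> (size f <= d.+1)%N ->
  u \in adjoin S e ->
  exists c : {poly E}, [/\ c \is a polyOver S, c != 0, root c u & (size c <= d.+1)%N].
Proof.
move=> /map_inclP[f' ->]; rewrite map_poly_eq0 size_map_poly => f0 fe sf.
move=> /adjoinP[_ [_ [/map_inclP[P ->] /map_inclP[Q ->] Q0 ->]]].
pose ev p := (map_poly (incl S) p).[e].
have evZ c p : ev (c *: p) = incl S c * ev p by rewrite /ev map_polyZ hornerZ.
have evD p q : ev (p + q) = ev p + ev q by rewrite /ev rmorphD hornerD.
have evM p q : ev (p * q) = ev p * ev q by rewrite /ev rmorphM hornerM.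
have evX p i : ev (p ^+ i) = ev p ^+ i by rewrite /ev rmorphXn horner_exp.
have ev0 : ev 0 = 0 by rewrite /ev rmorph0 horner0.
have ev_mod p : ev (p %% f') = ev p.
  by rewrite {2}(divp_eq p f') evD evM {3}/ev (eqP fe) mulr0 add0r.
pose A : 'M[subfield_type S]_(d.+1, d) :=
  \matrix_(i < d.+1) poly_rV ((P ^+ i * Q ^+ (d - i)) %% f').
have [v vA v0] : exists2 v : 'rV_d.+1, v *m A = 0 & v != 0.
  have : kermx A != 0.
    by rewrite -mxrank_eq0 mxrank_ker subn_eq0 -ltnNge (leq_ltn_trans (rank_leq_col A)).
  by case/rowV0Pn => v /sub_kermxP vA v0; exists v.
exists (map_poly (incl S) (rVpoly v)); split.
- by apply/map_inclP; eexists.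
- by rewrite map_poly_eq0; apply: contraNneq v0 => v0; rewrite -[v]rVpolyK v0 linear0.
- have ev_rel : \sum_(i < d.+1) incl S (v 0 i) * (ev P ^+ i * ev Q ^+ (d - i)) = 0.
    have modsum : \sum_(i < d.+1) v 0 i *: ((P ^+ i * Q ^+ (d - i)) %% f') = 0.
      have /(congr1 rVpoly) := vA; rewrite linear0 mulmx_sum_row linear_sum /= => rel.
      rewrite -[RHS]rel; apply: eq_bigr => i _; rewrite linearZ /= rowK poly_rV_K //.
      by rewrite -ltnS; apply: leq_trans sf; rewrite ltn_modp.
    rewrite -[RHS]ev0 -[in RHS]modsum (big_morph ev evD ev0); apply: eq_bigr => i _.
    by rewrite evZ ev_mod evM !evX.
  apply/eqP; rewrite (@horner_coef_wide _ d.+1) ?size_map_poly ?size_poly //.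
  apply: (mulIf (expf_neq0 d Q0)); rewrite mul0r -[RHS]ev_rel mulr_suml.
  apply: eq_bigr => i _; rewrite coef_map coef_rVpoly_ord -mulrA; congr (_ * _).
  have Qd : ev Q ^+ d = ev Q ^+ i * ev Q ^+ (d - i) by rewrite -exprD subnKC ?leq_ord.
  by rewrite expr_div_n -/(ev P) -/(ev Q) Qd mulrA divfK // expf_neq0.
- by rewrite size_map_poly size_poly.
Qed.

(** * Polynomials that are linear in a transcendental element *)

(** This is uniqueness of the expansion in base u: the constant digit is a
    multiple of u of smaller degree, hence zero, and then u can be cancelled. *)
Lemma digits_eq0 (k : fieldType) (u : {poly k}) (Q : {poly {poly k}}) :
  (forall i, (size (Q`_i)%R < size u)%N) -> Q.[u] = 0 -> Q = 0.
Proof.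
elim/poly_ind: Q => // Q c IH sQ; rewrite !hornerE => Qu0.
have c0 : c = 0.
  apply: contraTeq isT => c0.
  have : u %| c by rewrite -(dvdp_addr _ (dvdp_mulIr Q.[u] u)) Qu0 dvdp0.
  move/(dvdp_leq c0); rewrite leqNgt.
  by have := sQ 0%N; rewrite coefD coefMX coefC /= add0r => ->.
move: Qu0; rewrite c0 addr0 => /eqP; rewrite mulf_eq0 => /orP[/eqP Q0|/eqP u0].
  rewrite IH ?mul0r ?addr0 // => i.
  by have := sQ i.+1; rewrite coefD coefMX coefC /= addr0.
by have := sQ 0%N; rewrite u0 size_poly0.
Qed.

(** U - b is the generator of the kernel of the substitution b := U(T).  In a
    factorization, cleared of denominators so that both factors are polynomials
    in b and T over S, this substitution kills one of the factors; the digits of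
    that factor in base U then force its degree in T to be at least deg U. *)
Lemma irreducible_sub_transcendental (E : fieldType) (S : divringClosed E) (b : E)
    (U : {poly E}) :
  (forall Q, Q \is a polyOver S -> root Q b -> Q = 0) ->
  (forall x, x \in adjoin S b) ->
  U \is a polyOver S -> (1 < size U)%N ->
  irreducible_poly (U - b%:P).
Proof.
move=> b_tr genb /map_inclP[U' ->]; rewrite size_map_poly => sU.
set iota := incl S.
have [eps epsE] : exists eps : {rmorphism {poly subfield_type S} -> E},
    forall p, eps p = (map_poly iota p).[b].
  by exists (horner_eval b \o map_poly iota).
have eps_inj : injective eps.
  apply: raddf_inj => p pb; have {pb} : eps p = 0 := pb; rewrite epsE => /eqP pb.
  apply/eqP; have /eqP := b_tr _ (introT (map_inclP _ _) (ex_intro _ p erefl)) pb.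
  by rewrite map_poly_eq0.
pose meps := map_poly eps.
have mepsD p q : meps (p + q) = meps p + meps q by exact: rmorphD.
have mepsB p q : meps (p - q) = meps p - meps q by exact: rmorphB.
have mepsM p q : meps (p * q) = meps p * meps q by exact: rmorphM.
have mepsC c : meps c%:P = (eps c)%:P by exact: map_polyC.
have mepsX : meps 'X = 'X by exact: map_polyX.
have meps0 : meps 0 = 0 by exact: rmorph0.
have size_clear (q : {poly E}) delta D :
    delta != 0 -> eps delta *: q = meps D -> size q = size D.
  move=> delta0 qD; rewrite -(size_map_inj_poly eps_inj (rmorph0 eps)) -/meps -qD.
  by rewrite size_scale // -(rmorph0 eps) (inj_eq eps_inj).
have clear_denom (q : {poly E}) : exists (delta : {poly subfield_type S}) D,
    delta != 0 /\ eps delta *: q = meps D.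
  elim/poly_ind: q => [|q c [delta [D [delta0 qD]]]].
    by exists 1, 0; rewrite oner_neq0 scaler0 meps0.
  have /adjoinP[_ [_ [/map_inclP[A ->] /map_inclP[B ->] B0 cE]]] := genb c.
  exists (delta * B), (B%:P * D * 'X + (delta * A)%:P); split.
    rewrite mulf_neq0 //; apply: contraNneq B0 => ->.
    by rewrite rmorph0 horner0.
  rewrite -mul_polyC mepsD !mepsM !mepsC mepsX -qD !rmorphM /= -!mul_polyC.
  rewrite cE mulrDr -!epsE; congr (_ + _); first by ring.
  by rewrite -mulrA -polyCM mulrC [eps A / _]mulrC mulVKf ?epsE // mulrC.
(* The substitution b := U'(T). *)
pose ev (D : {poly {poly subfield_type S}}) : {poly subfield_type S} := (swapXY D).[U'].
have evM D D' : ev (D * D') = ev D * ev D' by rewrite /ev rmorphM hornerM.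
have evB D D' : ev (D - D') = ev D - ev D' by rewrite /ev raddfB hornerD hornerN.
have evU : ev (map_poly polyC U') = U' by rewrite /ev swapXY_map_polyC hornerC.
have evY : ev 'X%:P = U' by rewrite /ev swapXY_Y hornerX.
have ev_eq0 (D : {poly {poly subfield_type S}}) : (size D < size U')%N -> ev D = 0 -> D = 0.
  move=> sD /digits_eq0 D0; apply/eqP; rewrite -swapXY_eq0 D0 // => i.
  apply: leq_ltn_trans (max_size_coefXY _ _) _.
  by rewrite sizeYE swapXYK.
set P := _ - _.
have sP : size P = size U'.
  rewrite /P size_polyDl size_map_poly // size_polyN.
  by apply: leq_ltn_trans (size_polyC_leq1 _) sU.
have P0 : P != 0 by rewrite -size_poly_gt0 sP ltnW.
split=> [|q sq qP]; first by rewrite sP.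
rewrite -(dvdp_size_eqp qP) eqn_leq dvdp_leq //= leqNgt sP; apply/negP => ltq.
case/dvdpP: qP => r Pqr.
have [r0 q0] : r != 0 /\ q != 0 by apply/andP; rewrite -negb_or -mulf_eq0 -Pqr.
have ltr : (size r < size U')%N.
  have := congr1 (size \o polyseq) Pqr; rewrite /= sP size_mul // => ->.
  have : (1 < size q)%N by rewrite ltn_neqAle eq_sym sq size_poly_gt0.
  by case: (size q) => [|[|s]] // _; rewrite addnS /= addnS ltnS leq_addr.
have [d1 [D1 [d10 qD]]] := clear_denom q; have [d2 [D2 [d20 rD]]] := clear_denom r.
have rel : (d2 * d1)%:P * (map_poly polyC U' - 'X%:P) = D2 * D1.
  apply: (map_inj_poly eps_inj (rmorph0 eps)).
  rewrite -/meps !mepsM mepsB !mepsC -qD -rD -scalerAr -scalerAl scalerA -Pqr.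
  have -> : eps 'X = b by rewrite epsE map_polyX hornerX.
  rewrite rmorphM mul_polyC [eps d2 * _]mulrC; congr (_ *: (_ - _)).
  rewrite /meps -map_poly_comp; apply: eq_map_poly => c /=.
  by rewrite epsE map_polyC hornerC.
have /eqP : ev (D2 * D1) = 0.
  by rewrite -rel evM evB evU evY subrr mulr0.
rewrite evM mulf_eq0 => /orP[] /eqP /ev_eq0.
- rewrite -(size_clear _ _ _ d20 rD) => /(_ ltr) D20.
  by move: r0; rewrite -size_poly_eq0 (size_clear _ _ _ d20 rD) D20 size_poly0.
- rewrite -(size_clear _ _ _ d10 qD) => /(_ ltq) D10.
  by move: q0; rewrite -size_poly_eq0 (size_clear _ _ _ d10 qD) D10 size_poly0.
Qed.

(** * Derivations and their constants *)

Record derivation (E : fieldType) := Derivation {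
  deriv_fun :> E -> E;
  derivationD : {morph deriv_fun : x y / x + y};
  derivationM : forall x y, deriv_fun (x * y) = deriv_fun x * y + x * deriv_fun y }.

Section Constants.
Variables (E : fieldType) (D : derivation E).

Definition constants : {pred E} := fun x => D x == 0.

Lemma constantsP x : reflect (D x = 0) (x \in constants).
Proof. exact: eqP. Qed.

Let D0 : D 0 = 0.
Proof. by apply: (addrI (D 0)); rewrite -derivationD !addr0. Qed.

Let D1 : D 1 = 0.
Proof.
by apply: (addrI (D 1)); rewrite addr0 -[in RHS](mulr1 1) derivationM mulr1 mul1r.
Qed.

Let DN x : D (- x) = - D x.
Proof. by apply: (addrI (D x)); rewrite -derivationD !subrr. Qed.

Lemma constants_divring_closed : divring_closed constants.
Proof.
split=> [|x y /constantsP Dx /constantsP Dy|x y /constantsP Dx /constantsP Dy].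
- exact/constantsP.
- by apply/constantsP; rewrite derivationD DN Dx Dy subr0.
- have [->|y0] := eqVneq y 0; first by rewrite invr0 mulr0; apply/constantsP.
  apply/constantsP; rewrite derivationM Dx mul0r add0r.
  suff -> : D y^-1 = 0 by rewrite mulr0.
  apply: (mulfI y0); rewrite mulr0.
  by have := derivationM D y y^-1; rewrite mulfV // D1 Dy mul0r add0r.
Qed.

HB.instance Definition _ :=
  GRing.isDivringClosed.Build E constants constants_divring_closed.

Lemma derivation_horner (Q : {poly E}) (b : E) : Q \is a polyOver constants ->
  D Q.[b] = Q^`().[b] * D b.
Proof.
elim/poly_ind: Q => [|Q c IH]; first by rewrite deriv0 !horner0 D0 mul0r.
move=> /polyOverP SQ.
have SQ' : Q \is a polyOver constants.
  by apply/polyOverP => i; have := SQ i.+1; rewrite coefD coefMX coefC addr0.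
have /constantsP Dc : c \in constants.
  by have := SQ 0%N; rewrite coefD coefMX coefC add0r.
rewrite derivMXaddC !hornerE derivationD derivationM Dc addr0 IH //.
by rewrite mulrDl addrC mulrAC.
Qed.

(** Applying D to a relation Q(b) = 0 of minimal degree over the constants gives
    the relation Q'(b) = 0 of smaller degree, so Q' = 0 and Q is constant. *)
Lemma transcendental_over_constants (b : E) (Q : {poly E}) :
  (forall n, n.+1%:R != 0 :> E) -> D b != 0 ->
  Q \is a polyOver constants -> root Q b -> Q = 0.
Proof.
move=> char0 Db; move: {2}(size Q) (leqnn (size Q)) => s.
elim: s Q => [|s IH] Q; first by rewrite leqn0 size_poly_eq0 => /eqP.
move=> sQ SQ rQ.
have Q'0 : Q^`() = 0.
  have [->|Q0] := eqVneq Q 0; first exact: deriv0.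
  apply: IH.
  - by rewrite -ltnS; apply: leq_trans sQ; rewrite lt_size_deriv.
  - by apply: polyOver_deriv.
  - rewrite /root -(mulIr_eq0 _ (mulIf Db)) -derivation_horner //.
    by rewrite (eqP rQ) D0.
have sQ1 : (size Q <= 1)%N.
  apply/leq_sizeP => -[//|j] _; apply/eqP.
  have /eqP := congr1 (fun p : {poly E} => p`_j) Q'0.
  by rewrite coef_deriv coef0 -mulr_natr mulf_eq0 (negPf (char0 j)) orbF.
by move: rQ; rewrite (size1_polyC sQ1) /root hornerC => /eqP ->.
Qed.

Lemma derivation_nonconstant (b : E) :
  (exists x, D x != 0) -> (forall x, x \in adjoin constants b) -> D b != 0.
Proof.
move=> [x Dx] genb; apply: contraNneq Dx => Db0.
have /adjoinP[P [Q [SP SQ _ ->]]] := genb x.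
have Kb : b \in constants by apply/constantsP.
by apply/(rpred_div (rpred_horner SP Kb) (rpred_horner SQ Kb)).
Qed.

End Constants.

Theorem irreducible_sub_nonconstant (E : fieldType) (D : derivation E) (b : E)
    (U : {poly E}) :
  (forall n, n.+1%:R != 0 :> E) -> (exists x, D x != 0) ->
  (forall x, x \in adjoin (constants D) b) ->
  U \is a polyOver (constants D) -> (1 < size U)%N ->
  irreducible_poly (U - b%:P).
Proof.
move=> char0 D0 genb; apply: irreducible_sub_transcendental => // Q.
by apply: transcendental_over_constants => //; apply: derivation_nonconstant.
Qed.

(** * The polynomial of a weighted lift *)

Section WeightedPolynomial.
Variables (E : fieldType) (H : {poly E}) (A B C c : E).
Hypothesis char0 : forall n, n.+1%:R != 0 :> E.
Hypothesis sH : (2 < size H)%N.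

Definition weighted_poly : {poly E} := H - (B * C) *: 'X + (c * A * C ^+ 2)%:P.

Lemma size_weighted_poly : size weighted_poly = size H.
Proof.
rewrite /weighted_poly -addrA size_polyDl //; apply: leq_ltn_trans (size_polyD _ _) _.
rewrite gtn_max size_polyN (leq_ltn_trans (size_scale_leq _ _)) ?size_polyX //=.
by rewrite (leq_ltn_trans (size_polyC_leq1 _)) // ltnW.
Qed.

Lemma horner_weighted_poly w : weighted_poly.[w] = H.[w] - B * C * w + c * A * C ^+ 2.
Proof. by rewrite !hornerD hornerN hornerZ hornerX hornerC. Qed.

(** Subtracting P(w) = 0 from P shows that P / (T - w) is the difference of
    (H - H(w)) / (T - w), whose coefficients are constants of D, and of B C. *)
Lemma irreducible_weighted_quotient (D : derivation E) (w : E) :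
  (exists x, D x != 0) -> (forall x, x \in adjoin (constants D) (B * C)) ->
  H \is a polyOver (constants D) -> w \in constants D -> root weighted_poly w ->
  exists2 P1, weighted_poly = ('X - w%:P) * P1 & irreducible_poly P1.
Proof.
move=> D0 gen DH Dw rw; pose b := B * C; pose U := (H - H.[w]%:P) %/ ('X - w%:P).
have HU : H - H.[w]%:P = U * ('X - w%:P).
  by apply/esym/divpK; rewrite dvdp_XsubCl /root hornerD hornerN hornerC subrr.
have S_U : U \is a polyOver (constants D).
  by apply: divp_polyOver; rewrite rpredB ?polyOverX ?polyOverC ?rpred_horner.
have sHw : size (H - H.[w]%:P) = size H.
  rewrite size_polyDl // size_polyN.
  by apply: leq_ltn_trans (size_polyC_leq1 _) _; rewrite ltnW.
have sU : (1 < size U)%N.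
  have U0 : U != 0.
    by apply: contraTneq sH => U0; rewrite -sHw HU U0 mul0r size_poly0.
  by move: sHw sH; rewrite HU size_Mmonic ?monicXsubC // size_XsubC addn2 /= => <-.
exists (U - b%:P); last exact: irreducible_sub_nonconstant char0 D0 gen S_U sU.
have -> : weighted_poly = H - b *: 'X - (H.[w] - b * w)%:P.
  rewrite /weighted_poly -/b; congr (_ + _); rewrite -polyCN; congr _%:P.
  by apply/eqP; rewrite -addr_eq0 addrC; move: rw; rewrite /root horner_weighted_poly.
by clearbody b; rewrite [RHS]mulrC mulrBl -HU -mul_polyC polyCB polyCM; ring.
Qed.

Lemma irreducible_weighted_poly (D : derivation E) :
  (exists x, D x != 0) -> (forall x, x \in adjoin (constants D) (- (c * A * C ^+ 2))) ->
  H \is a polyOver (constants D) -> B \in constants D -> C \in constants D ->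
  irreducible_poly weighted_poly.
Proof.
move=> D0 gen DH DB DC.
have -> : weighted_poly = (H - (B * C) *: 'X) - (- (c * A * C ^+ 2))%:P.
  by rewrite polyCN opprK.
apply: irreducible_sub_nonconstant char0 D0 gen _ _.
- by rewrite rpredB // polyOverZ ?polyOverX // rpredM.
- rewrite size_polyDl; first exact: ltnW.
  by rewrite size_polyN; apply: leq_ltn_trans (size_scale_leq _ _) _; rewrite size_polyX.
Qed.
End WeightedPolynomial.

(** The field E stands for the function field of a stabilized weighted lift: K0
    for the ground field, u for the extra coordinates, k for the field generated
    by A, B, C and u. *)
Section WeightedPrimitivity.
Variables (E : fieldType) (K0 : {pred E}) (I : Type) (u : I -> E).
Variables (H : {poly E}) (A B C c w : E) (k : divringClosed E).
Hypothesis char0 : forall n, n.+1%:R != 0 :> E.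
Hypothesis sH : (2 < size H)%N.
Hypothesis K0H : forall i, H`_i \in K0.
Hypothesis K0c : c \in K0.
Hypothesis c0 : c != 0.
Hypothesis relw : root (weighted_poly H A B C c) w.
Hypothesis kill : forall x y : E, exists D : derivation E,
  [/\ x \in constants D, y \in constants D, forall i, u i \in constants D,
      {subset K0 <= constants D} & exists f, D f != 0].
Hypothesis gen : forall S : divringClosed E, {subset K0 <= S} ->
  A \in S -> B \in S -> C \in S -> (forall i, u i \in S) -> w \in S -> forall f, f \in S.
Hypothesis k_sub : forall S : divringClosed E, {subset K0 <= S} ->
  A \in S -> B \in S -> C \in S -> (forall i, u i \in S) -> {subset k <= S}.
Hypothesis kK0 : {subset K0 <= k}.
Hypothesis kABC : [/\ A \in k, B \in k & C \in k].

Let H_over (S : divringClosed E) : {subset K0 <= S} -> H \is a polyOver S.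
Proof. by move=> K0S; apply/polyOverP => i; apply: K0S. Qed.

(* If C were zero then H(w) = 0 would make w algebraic over K0, hence a constant
   of a derivation that also kills A, B and u. *)
Let C_neq0 : C != 0.
Proof.
apply/negP => /eqP C0; have [D [DA DB Du DK0 [f Df]]] := kill A B.
case/negP: Df; apply: (gen DK0 DA DB _ Du); first by rewrite C0 rpred0.
apply/negPn/negP => Dw.
have H0 : H = 0.
  apply: transcendental_over_constants char0 Dw (H_over DK0) _.
  by move: relw; rewrite /root horner_weighted_poly C0 mulr0 mul0r subr0 expr0n mulr0 addr0.
by have := sH; rewrite H0 size_poly0.
Qed.

Theorem weighted_poly_primitive : exists P P1 : {poly E},
  [/\ P \is a polyOver k, P = ('X - w%:P) * P1, irreducible_poly P1,
      w \notin k & size P = size H].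
Proof.
have cC0 : c * C ^+ 2 != 0 by rewrite mulf_neq0 ?expf_neq0.
pose P := weighted_poly H A B C c.
(* A derivation killing B, C and u makes P irreducible over the field generated
   by A, B, C and u; if w were in k, that field would contain a root of P. *)
have wNk : w \notin k.
  apply/negP => kw; have [D [DB DC Du DK0 D0]] := kill B C.
  pose b := - (c * A * C ^+ 2).
  have Sbase x : x \in constants D -> x \in adjoin (constants D) b by exact: mem_adjoin_base.
  have SK0 : {subset K0 <= adjoin (constants D) b} by move=> x /DK0; exact: Sbase.
  have SA : A \in adjoin (constants D) b.
    have -> : A = - b / (c * C ^+ 2) by rewrite /b; field; rewrite C_neq0 c0.
    have ScC : c * C ^+ 2 \in adjoin (constants D) b by rewrite rpredM ?rpredX ?(SK0 c) ?(Sbase C).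
    by apply: rpred_div => //; rewrite rpredN; exact: mem_adjoin_gen.
  have genb : forall x, x \in adjoin (constants D) b.
    apply: gen => //; [exact: Sbase | exact: Sbase | by move=> i; apply: Sbase |].
    by apply: k_sub kw => //; [exact: Sbase | exact: Sbase | by move=> i; apply: Sbase].
  have irrP := irreducible_weighted_poly char0 sH D0 genb (H_over DK0) DB DC.
  have /eqp_size : 'X - w%:P %= P by apply: irrP; rewrite ?size_XsubC // dvdp_XsubCl.
  by rewrite size_XsubC size_weighted_poly // => s2; have := sH; rewrite -s2.
(* A derivation killing w, C and u: then E is generated by B C over its constants. *)
have [D [Dw DC Du DK0 D0]] := kill w C.
pose b := B * C.
have Sbase x : x \in constants D -> x \in adjoin (constants D) b by exact: mem_adjoin_base.
have Sb : b \in adjoin (constants D) b by exact: mem_adjoin_gen.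
have SK0 : {subset K0 <= adjoin (constants D) b} by move=> x /DK0; exact: Sbase.
have SC := Sbase _ DC; have Sw := Sbase _ Dw.
have SB : B \in adjoin (constants D) b by rewrite -[B](mulfK C_neq0) rpred_div.
have SA : A \in adjoin (constants D) b.
  have -> : A = (b * w - H.[w]) / (c * C ^+ 2).
    apply: (mulIf cC0); rewrite divfK //; move: relw.
    rewrite /root horner_weighted_poly => /eqP rel.
    by apply/eqP; rewrite -subr_eq0; apply/eqP; rewrite -[RHS]rel /b; ring.
  have SH : H.[w] \in adjoin (constants D) b by rewrite rpred_horner ?H_over.
  by rewrite rpred_div ?rpredB ?rpredM ?rpredX ?(SK0 c).
have genb : forall x, x \in adjoin (constants D) b.
  by apply: gen => // i; apply: Sbase.
have [P1 PE irrP1] := irreducible_weighted_quotient char0 sH D0 genb (H_over DK0) Dw relw.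
exists P, P1; split=> //; last by rewrite size_weighted_poly.
have [kA kB kC] := kABC.
rewrite rpredD ?rpredB ?H_over ?polyOverZ ?polyOverX ?polyOverC //.
  by rewrite rpredM.
by rewrite !rpredM ?rpredX // kK0.
Qed.
End WeightedPrimitivity.

(** * Primitivity excludes towers *)

(** The gcd of P and Q has coefficients in S and equals T - w times a divisor of
    the irreducible P1; the bound on the degree of Q excludes P itself, so the
    gcd is T - w up to a unit. *)
Lemma primitive_root_dichotomy (E : fieldType) (S : divringClosed E) (w : E)
    (P P1 Q : {poly E}) :
  P \is a polyOver S -> P = ('X - w%:P) * P1 -> irreducible_poly P1 ->
  Q \is a polyOver S -> Q != 0 -> root Q w -> (size Q < size P)%N -> w \in S.
Proof.
move=> SP PE irr SQ Q0 rQ sQP.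
have SD := gcdp_polyOver SP SQ; set D := gcdp P Q in SD.
have [r DE] : exists r, D = r * ('X - w%:P).
  by apply/factor_theorem; rewrite root_gcd rQ PE rootM root_XsubC eqxx.
have rP1 : r %| P1.
  rewrite -(@dvdp_mul2l _ ('X - w%:P)) ?polyXsubC_eq0 // -PE mulrC -DE.
  exact: dvdp_gcdl.
have D0 : D != 0 by rewrite gcdp_eq0 negb_and Q0 orbT.
have r0 : r != 0 by apply: contraNneq D0 => r0; rewrite DE r0 mul0r.
case/(irredp_XsubCP irr): rP1 => [r1|/eqp_size sr].
- have sr : size r = 1%N by rewrite (eqp_size r1) size_poly1.
  have rC := size1_polyC (eq_leq sr); set c := r`_0 in rC.
  have c0 : c != 0 by rewrite -polyC_eq0 -rC.
  move/polyOverP: SD => SD.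
  have Sc : c \in S.
    by have := SD 1%N; rewrite DE rC coefCM coefB coefX coefC subr0 mulr1.
  have := SD 0%N; rewrite DE rC coefCM coefB coefX coefC sub0r mulrN rpredN => Scw.
  by rewrite -[w](mulKf c0) rpredM ?rpredV.
- have : (size D <= size Q)%N by apply: dvdp_leq => //; exact: dvdp_gcdr.
  rewrite leqNgt DE; suff -> : size (r * ('X - w%:P)) = size P by rewrite sQP.
  by rewrite PE mulrC !size_monicM ?monicXsubC ?(irredp_neq0 irr) // sr.
Qed.

(** The element w has degree at most m over k(t), hence lies in k(t); it then has
    degree at most n over k, hence would lie in k. *)
Theorem no_proper_tower (E : fieldType) (k : divringClosed E) (w t p : E)
    (P P1 f g : {poly E}) (n m : nat) :
  P \is a polyOver k -> P = ('X - w%:P) * P1 -> irreducible_poly P1 -> w \notin k ->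
  f \is a polyOver k -> f != 0 -> root f t -> (size f <= n.+1)%N ->
  g \is a polyOver (adjoin k t) -> g != 0 -> root g p -> (size g <= m.+1)%N ->
  (n.+1 < size P)%N -> (m.+1 < size P)%N ->
  w \notin adjoin (adjoin k t) p.
Proof.
move=> kP PE irr wNk kf f0 rf sf kg g0 rg sg nP mP.
apply: contra wNk => wtp.
have w_kt : w \in adjoin k t.
  have [Q [SQ Q0 rQ sQ]] := adjoin_degree_bound kg g0 rg sg wtp.
  apply: primitive_root_dichotomy PE irr SQ Q0 rQ (leq_ltn_trans sQ mP).
  by apply: polyOverS kP => x; apply: mem_adjoin_base.
have [Q [SQ Q0 rQ sQ]] := adjoin_degree_bound kf f0 rf sf w_kt.
exact: primitive_root_dichotomy PE irr SQ Q0 rQ (leq_ltn_trans sQ nP).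
Qed.

(** * The polynomial Phi and its root x / p *)

(** [h] stands for one half, so that the formula makes sense over any ring and
    can be moved along ring morphisms. *)
Section FiberPolynomial.
Variables (R : comNzRingType) (n : nat) (h x y : R) (z : nat -> R).

Definition fiber_bracket : {poly R} :=
  (n%:R * y) *: (y *: 'X + h%:P) + z 3 *: ((1 + x * y) *: 'X + (h * x)%:P)
  + \sum_(4 <= j < n.+1) z j *: 'X^(j - 2).

Definition fiber_poly : {poly R} :=
  let L := (1 + x * y) *: 'X - x%:P in
  (1 - y *: 'X) ^+ n.-1 * L + L ^+ 2 * fiber_bracket.

Lemma coef_fiber_tail k :
  (\sum_(4 <= j < n.+1) z j *: 'X^(j - 2))`_k
  = if (1 < k < n.-1)%N then z k.+2 else 0.
Proof.
rewrite coef_sum.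
under eq_bigr do rewrite coefZ coefXn.
case: ifP => [/andP[k1 kn]|kN].
  rewrite (bigD1_seq k.+2) ?iota_uniq ?mem_index_iota //=; last by lia.
  rewrite subn2 eqxx mulr1 big_seq_cond big1 ?addr0 // => j.
  rewrite mem_index_iota => /andP[j4 jk].
  by case: eqP => [kE|_]; [move: j4 jk kE; lia | rewrite mulr0].
rewrite big_seq_cond big1 // => j; rewrite andbT mem_index_iota => j4.
by case: eqP => [kE|_]; [move: kN j4 kE; lia | rewrite mulr0].
Qed.

Lemma coef_fiber_bracket k :
  fiber_bracket`_k =
    if k == 0%N then n%:R * y * h + z 3 * (h * x)
    else if k == 1%N then n%:R * y * y + z 3 * (1 + x * y)
    else if (k < n.-1)%N then z k.+2 else 0.
Proof.
rewrite !coefD coef_fiber_tail !coefZ !coefD !coefZ !coefX !coefC.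
by case: k => [|[|k]] /=; rewrite ?(mulr0, mulr1, add0r, addr0) ?mulrA.
Qed.

Lemma size_fiber_poly : (3 < n)%N -> (size fiber_poly <= n.+1)%N.
Proof.
move=> n3; rewrite /fiber_poly; set L := _ *: 'X - x%:P.
have sZX (a : R) : (size (a *: 'X : {poly R})%R <= 2)%N.
  by apply: leq_trans (size_scale_leq _ _) _; rewrite size_polyX.
have sC (a : R) : (size (a%:P : {poly R})%R <= 2)%N.
  exact: leq_trans (size_polyC_leq1 _) _.
have sL : (size L <= 2)%N.
  by apply: leq_trans (size_polyD _ _) _; rewrite geq_max size_polyN sZX sC.
have sY : (size (1 - y *: 'X : {poly R})%R <= 2)%N.
  by apply: leq_trans (size_polyD _ _) _; rewrite geq_max size_polyN sZX size_poly1.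
have sB : (size fiber_bracket <= n.-1)%N.
  apply/leq_sizeP => k; rewrite coef_fiber_bracket => nk.
  by case: k nk => [|[|k]] nk; [lia | lia | rewrite /= ltnNge nk].
have sX (A : {poly R}) i : (size A <= 2)%N -> (size (A ^+ i)%R <= i.+1)%N.
  by move=> sA; apply: leq_trans (size_poly_exp_leq _ _) _; rewrite ltnS; nia.
have sM (A B : {poly R}) i j : (size A <= i)%N -> (size B <= j)%N ->
    (i + j <= n.+2)%N -> (size (A * B)%R <= n.+1)%N.
  by move=> sA sB' ij; apply: leq_trans (size_polyMleq _ _) _; lia.
rewrite (leq_trans (size_polyD _ _)) // geq_max.
by rewrite (sM _ _ _ _ (sX _ _ sY) sL) ?(sM _ _ _ _ (sX _ _ sL) sB) //; lia.
Qed.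

Lemma coef1_fiber_poly : (3 < n)%N -> h + h = 1 -> fiber_poly`_1 = 1.
Proof.
move=> n3 hh; rewrite /fiber_poly.
have coef1 (Q : {poly R}) : Q`_1 = Q^`().[0] by rewrite horner_coef0 coef_deriv.
have B0 : fiber_bracket.[0] = n%:R * y * h + z 3 * (h * x).
  by rewrite horner_coef0 coef_fiber_bracket.
have B1 : fiber_bracket^`().[0] = n%:R * y * y + z 3 * (1 + x * y).
  by rewrite -coef1 coef_fiber_bracket.
move: fiber_bracket B0 B1 => B B0 B1.
rewrite coef1 !derivE deriv_exp !derivE !hornerE ?hornerMn ?horner_exp !hornerE.
rewrite B0 B1 !subr0 !expr1n !mulr1.
have -> : n%:R = 1 + n.-1%:R :> R by rewrite -(natrD _ 1) add1n prednK // (ltn_trans _ n3).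
rewrite -mulr_natr; set N := n.-1%:R.
(* The terms are grouped so that h occurs only in h + h. *)
transitivity (1 + x * y + N * x * y
  - (1 + x * y) * x * (h + h) * ((1 + N) * y + z 3 * x)
  + x ^+ 2 * ((1 + N) * y ^+ 2 + z 3 * (1 + x * y))); last by rewrite hh; ring.
by rewrite /=; ring.
Qed.

End FiberPolynomial.

Lemma map_fiber_poly (R R' : comNzRingType) (theta : {rmorphism R -> R'}) n h x y z :
  map_poly theta (fiber_poly n h x y z)
  = fiber_poly n (theta h) (theta x) (theta y) (theta \o z).
Proof.
rewrite /fiber_poly /fiber_bracket; set m := map_poly theta.
have mD P Q : m (P + Q) = m P + m Q by exact: rmorphD.
have mB P Q : m (P - Q) = m P - m Q by exact: rmorphB.
have mM P Q : m (P * Q) = m P * m Q by exact: rmorphM.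
have mX i P : m (P ^+ i) = m P ^+ i by exact: rmorphXn.
have mZ a P : m (a *: P) = theta a *: m P by exact: map_polyZ.
have mC a : m a%:P = (theta a)%:P by exact: map_polyC.
have m1 : m 1 = 1 by exact: rmorph1.
have mV : m 'X = 'X by exact: map_polyX.
have msum : m (\sum_(4 <= j < n.+1) z j *: 'X^(j - 2)) =
    \sum_(4 <= j < n.+1) theta (z j) *: 'X^(j - 2).
  rewrite (big_morph m mD (rmorph0 _)); apply: eq_bigr => j _.
  by rewrite mZ mX mV.
by rewrite !(mB, mX, mD, mM, mZ, mC, m1, mV, msum) !(rmorphD, rmorphM, rmorph1, rmorph_nat).
Qed.

Lemma eq_fiber_poly (R : comNzRingType) n (h x y : R) (z z' : nat -> R) :
  (3 < n)%N ->
  (forall j, (3 <= j <= n)%N -> z j = z' j) ->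
  fiber_poly n h x y z = fiber_poly n h x y z'.
Proof.
move=> n3 zz'; rewrite /fiber_poly; congr (_ + _ * _).
apply/polyP => k; rewrite !coef_fiber_bracket zz' ?(ltnW n3) //.
by case: k => [|[|k]] //=; case: ifP => // kn; apply: zz'; lia.
Qed.

Section FiberOverField.
Variables (E : fieldType) (n : nat) (h x y : E) (z : nat -> E).
Let p := 1 + x * y.
Hypothesis p0 : p != 0.
Local Notation Phi := (fiber_poly n h x y z).

Let L0 : (p *: 'X - x%:P).[x / p] = 0.
Proof. by rewrite hornerD hornerN hornerZ hornerX hornerC mulrC divfK // subrr. Qed.

Lemma root_fiber_poly : root Phi (x / p).
Proof.
rewrite /root /fiber_poly -/p; move: (p *: 'X - x%:P) L0 => L L0'.
by rewrite hornerD !hornerM L0' mulr0 !mul0r addr0.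
Qed.

Lemma deriv_fiber_poly : (1 < n)%N -> p ^+ (n - 2) * Phi^`().[x / p] = 1.
Proof.
move=> n1; rewrite /fiber_poly -/p; move: (fiber_bracket _ _ _ _ _) => B.
have L1 : (p *: 'X - x%:P)^`() = p%:P by rewrite !derivE subr0 alg_polyC.
move: (p *: 'X - x%:P) L0 L1 => L L0' L1.
have -> : (((1 - y *: 'X) ^+ n.-1 * L + L ^+ 2 * B)^`()).[x / p]
    = (1 - y * (x / p)) ^+ n.-1 * p.
  rewrite derivD !derivM L1 !(hornerD, hornerM) L0' hornerC !(mulr0, mul0r, addr0, add0r).
  by rewrite horner_exp hornerD hornerN hornerZ hornerX hornerC.
have -> : 1 - y * (x / p) = p^-1.
  by have p0' := p0; rewrite /p in p0' *; field.
have -> : n.-1 = (n - 2).+1 by lia.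
by rewrite exprSr mulrA mulrA -exprMn divff // expr1n mul1r mulVf.
Qed.

(** Since x <> 0 and p <> 0, the coordinate y is (p - 1) / x, and dividing by
    (p T - x)^2 exhibits the coefficients of the bracket, from which the z_j are
    read off. *)
Lemma fiber_coords_mem (S : divringClosed E) : (3 < n)%N -> x != 0 ->
  Phi \is a polyOver S -> x \in S -> p \in S ->
  y \in S /\ forall j, (3 <= j <= n)%N -> z j \in S.
Proof.
move=> n3 x0 SPhi Sx Sp.
have Sy : y \in S.
  have -> : y = (p - 1) / x by rewrite /p; field.
  by rewrite rpred_div ?rpredB ?rpred1.
split=> //; set L := p *: 'X - x%:P.
have SL : L \is a polyOver S by rewrite rpredB ?polyOverZ ?polyOverX ?polyOverC.
have L_neq0 : L != 0.
  apply: contraNneq p0 => /(congr1 (fun q : {poly E} => q`_1)).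
  by rewrite coefB coefZ coefX coefC coef0 mulr1 subr0 => /eqP.
have SB : fiber_bracket n h x y z \is a polyOver S.
  have -> : fiber_bracket n h x y z = (Phi - (1 - y *: 'X) ^+ n.-1 * L) %/ L ^+ 2.
    by rewrite /fiber_poly -/p -/L addrC addKr mulrC mulpK // expf_neq0.
  rewrite divp_polyOver ?rpredX // rpredB // rpredM // rpredX //.
  by rewrite rpredB ?rpred1 ?polyOverZ ?polyOverX.
move/polyOverP: SB => SB j jn.
have [->|j3] := eqVneq j 3%N.
  have := SB 1%N; rewrite coef_fiber_bracket /= -/p => Szp.
  have -> : z 3 = (n%:R * y * y + z 3 * p - n%:R * y * y) / p by field.
  by rewrite rpred_div // rpredB // !rpredM // rpred_nat.
have := SB (j - 2)%N; rewrite coef_fiber_bracket.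
have -> : ((j - 2)%N == 0%N) = false by lia.
have -> : ((j - 2)%N == 1%N) = false by lia.
have -> : (j - 2 < n.-1)%N by lia.
by have -> : (j - 2).+2 = j by lia.
Qed.
End FiberOverField.

Lemma coef1_exp_sub (R : comNzRingType) (y : R) k :
  ((1 - y *: 'X) ^+ k)`_1 = - (k%:R * y).
Proof.
have -> : ((1 - y *: 'X) ^+ k)`_1 = ((1 - y *: 'X) ^+ k)^`().[0].
  by rewrite horner_coef0 coef_deriv.
rewrite deriv_exp !derivE hornerMn hornerM horner_exp !hornerE subr0 expr1n.
by rewrite -mulr_natl mulr1 mulrN.
Qed.

(** Every prescription of the lower coefficients is attained at a point with
    x = 0, where p = 1 and p T - x = T, and at a point with x = 1 and p = 0, where
    p T - x = -1; in both cases the system is triangular in the z_j.  Hence neither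
    x nor p vanishes identically on the locus of a descent. *)
Section FiberPoints.
Variables (K : fieldType) (n : nat) (v : nat -> K).
Hypothesis char0 : forall i, i.+1%:R != 0 :> K.
Hypothesis n3 : (3 < n)%N.

Lemma fiber_point_x0 : exists y z,
  forall j, (2 <= j <= n - 2)%N -> (fiber_poly n 2^-1 0 y z)`_j = v j.
Proof.
have two0 : 2 != 0 :> K by apply: char0.
(* At x = 0 the coefficient of T^2 is - (n - 1) y + n y / 2, free of the z_j. *)
pose y := - 2 * v 2 / (n - 2)%:R.
pose z j := v j - ((1 - y *: 'X) ^+ n.-1)`_j.-1 - (if j == 3%N then n%:R * y * y else 0).
exists y, z => -[|[|i]] //; rewrite !ltnS => i_le; rewrite /fiber_poly mul0r addr0 scale1r subr0.
rewrite coefD coefMX coefXnM /= !subSS subn0 coef_fiber_bracket.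
have [-> /=|i0] := eqVneq i 0%N.
  rewrite coef1_exp_sub.
  have -> : n.-1 = (n - 2).+1 by lia.
  have -> : n%:R = (n - 2)%:R + 2 :> K by rewrite -natrD; congr _%:R; lia.
  have N0 : (n - 2)%:R != 0 :> K by have -> : (n - 2 = (n - 3).+1)%N by lia.
  by rewrite /y -natr1; field; rewrite N0 two0.
have -> : (i < n.-1)%N by lia.
rewrite /z /=; case: eqP => [-> /=|i1]; first by ring.
have -> : (i.+2 == 3)%N = false by lia.
by rewrite subr0 addrC subrK.
Qed.

Lemma fiber_point_p0 : exists z,
  forall j, (2 <= j <= n - 2)%N -> (fiber_poly n 2^-1 1 (-1) z)`_j = v j.
Proof.
pose a := (1 - (-1) *: 'X : {poly K}) ^+ n.-1.
(* The coefficient of T^j is z_(j + 2) minus that of (1 + T)^(n - 1). *)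
exists (fun i => if (3 < i)%N then v (i - 2)%N + a`_(i - 2) else 0) => -[|[|j]] // jn.
rewrite /fiber_poly mul1r subrr scale0r sub0r sqrrN expr1n mul1r mulrN mulr1.
rewrite coefD coefN -/a coef_fiber_bracket /=.
have -> : (j.+2 < n.-1)%N by lia.
by rewrite !subSS subn0 addrC addrK.
Qed.
End FiberPoints.

(** * Towers for the fibres of K_n *)

Lemma fiber_degree_bounds n : (3 < n)%N ->
  (n < n * (n - 2))%N /\ (n - 2 < n * (n - 2))%N.
Proof. by move=> n3; split; nia. Qed.

(** The tower is k, k(t), k(t)(p) with t = x / p; over k(t) the element p is a
    root of Phi'(t) T^(n - 2) - 1. *)
Theorem fiber_not_primitive (E : fieldType) (k : divringClosed E) (n : nat) (h x y : E)
    (z : nat -> E) (w : E) (P P1 : {poly E}) :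
  (3 < n)%N -> h + h = 1 -> x != 0 -> 1 + x * y != 0 ->
  fiber_poly n h x y z \is a polyOver k ->
  P \is a polyOver k -> P = ('X - w%:P) * P1 -> irreducible_poly P1 -> w \notin k ->
  size P = (n * (n - 2)).+1 ->
  ~ (forall S : divringClosed E, {subset k <= S} -> x \in S -> y \in S ->
       (forall j, (3 <= j <= n)%N -> z j \in S) -> w \in S).
Proof.
move=> n3 hh x0 p0 kPhi kP PE irr wNk sP gen.
set Phi := fiber_poly n h x y z in kPhi; set p := 1 + x * y in p0; pose t := x / p.
have Phi0 : Phi != 0.
  apply: contraNneq (oner_neq0 E) => Phi0.
  by rewrite -(coef1_fiber_poly x y z n3 hh) -/Phi Phi0 coef0.
pose k_t := adjoin k t : divringClosed E; pose k_tp := adjoin k_t p : divringClosed E.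
have k_kt : {subset k <= k_t} by move=> a ka; apply: mem_adjoin_base.
have kt_ktp : {subset k_t <= k_tp} by move=> a ka; apply: mem_adjoin_base.
have k_ktp : {subset k <= k_tp} by move=> a /k_kt /kt_ktp.
have St : t \in k_t by apply: mem_adjoin_gen.
have Sp : p \in k_tp by apply: mem_adjoin_gen.
pose g := (Phi^`().[t])%:P * 'X^(n - 2) - 1.
have g_over : g \is a polyOver k_t.
  rewrite rpredB ?rpred1 // rpredM ?rpredX ?polyOverX // polyOverC rpred_horner //.
  by apply: polyOver_deriv; apply: polyOverS kPhi.
have g0 : g != 0.
  apply: contraTneq (oner_neq0 E) => /(congr1 (fun q : {poly E} => q.[0])).
  rewrite hornerD hornerN hornerM hornerXn expr0n !hornerC subn_eq0 leqNgt (ltn_trans _ n3) //.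
  by rewrite mulr0 sub0r => /eqP; rewrite oppr_eq0 => ->.
have rg : root g p.
  rewrite /root hornerD hornerN hornerM hornerXn !hornerC mulrC.
  by rewrite deriv_fiber_poly ?subrr // (ltn_trans _ n3).
have sg : (size g <= (n - 2).+1)%N.
  rewrite (leq_trans (size_polyD _ _)) // geq_max size_polyN size_poly1 andbT.
  by rewrite mul_polyC (leq_trans (size_scale_leq _ _)) ?size_polyXn.
have Sx : x \in k_tp.
  have -> : x = t * p by rewrite /t divfK.
  by apply: rpredM => //; exact: kt_ktp.
have [Sy Sz] := fiber_coords_mem p0 n3 x0 (polyOverS k_ktp kPhi) Sx Sp.
have [n_lt m_lt] := fiber_degree_bounds n3.
have nP : (n.+1 < size P)%N by rewrite sP ltnS.
have mP : ((n - 2).+1 < size P)%N by rewrite sP ltnS.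
have wN := no_proper_tower kP PE irr wNk kPhi Phi0 (root_fiber_poly _ _ _ p0)
  (size_fiber_poly _ _ _ _ n3) g_over g0 rg sg nP mP.
by case/negP: wN; exact: (gen k_tp k_ktp Sx Sy Sz).
Qed.

(** * Fields of fractions: extending morphisms and derivations *)

Lemma quotient_rule_add (F : fieldType) (f g u v a a' c c' : F) : u != 0 -> v != 0 ->
  (a * v + f * u * c' + (a' * u + g * v * c) - (f + g) * (c * v + u * c')) / (u * v)
  = (a - f * c) / u + (a' - g * c') / v.
Proof. by move=> u0 v0; field; rewrite u0 v0. Qed.

Lemma quotient_rule_mul (F : fieldType) (f g u v a a' c c' : F) : u != 0 -> v != 0 ->
  (a * (g * v) + f * u * a' - f * g * (c * v + u * c')) / (u * v)
  = (a - f * c) / u * g + f * ((a' - g * c') / v).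
Proof. by move=> u0 v0; field; rewrite u0 v0. Qed.

Section Fractions.
Variable R : idomainType.
Local Notation F := {fraction R}.

Definition numer (f : F) : R := \n_(repr f).
Definition denom (f : F) : R := \d_(repr f).

Lemma denom_neq0 f : denom f != 0.
Proof. exact: denom_ratioP. Qed.

Lemma tofrac_neq0 (a : R) : a != 0 -> tofrac a != 0.
Proof. by rewrite tofrac_eq0. Qed.

Lemma numer_denom f : tofrac (numer f) = f * tofrac (denom f).
Proof.
rewrite -[X in X * _]reprK /numer /denom; move: (repr f) => x.
unlock tofrac; rewrite -[RHS]FracField.pi_mul; apply/eqmodP.
rewrite /= FracField.equivfE /FracField.mulf !numden_Ratio ?(oner_eq0, mulf_neq0) ?denom_ratioP //.
by rewrite mulr1 mul1r mulrC.
Qed.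

Section Extension.
Variables (E : fieldType) (phi : {rmorphism R -> E}).
Hypothesis phi_inj : injective phi.

Definition frac_ext (f : F) : E := phi (numer f) / phi (denom f).

Let phi_neq0 a : a != 0 -> phi a != 0.
Proof. by rewrite -(inj_eq phi_inj) rmorph0. Qed.

Let extE f a b : b != 0 -> tofrac a = f * tofrac b -> frac_ext f = phi a / phi b.
Proof.
move=> b0 fE; apply/eqP; rewrite /frac_ext eqr_div ?phi_neq0 ?denom_neq0 //.
rewrite -!rmorphM (inj_eq phi_inj) -tofrac_eq !rmorphM /= numer_denom fE.
by rewrite mulrAC.
Qed.

Lemma frac_ext_is_zmod_morphism : zmod_morphism frac_ext.
Proof.
move=> f g; rewrite (@extE _ (numer f * denom g - numer g * denom f) (denom f * denom g)).
- by rewrite rmorphB !rmorphM /frac_ext -[in RHS]mulNr addf_div ?phi_neq0 ?denom_neq0 // mulNr.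
- by rewrite mulf_neq0 ?denom_neq0.
- by rewrite rmorphB !rmorphM /= !numer_denom; ring.
Qed.

Lemma frac_ext_is_monoid_morphism : monoid_morphism frac_ext.
Proof.
split=> [|f g].
  by rewrite (@extE 1 1 1) ?oner_neq0 ?mul1r // rmorph1 divr1.
rewrite (@extE _ (numer f * numer g) (denom f * denom g)).
- by rewrite !rmorphM mulf_div.
- by rewrite mulf_neq0 ?denom_neq0.
- by rewrite !rmorphM /= !numer_denom; ring.
Qed.

HB.instance Definition _ :=
  GRing.isZmodMorphism.Build F E frac_ext frac_ext_is_zmod_morphism.
HB.instance Definition _ :=
  GRing.isMonoidMorphism.Build F E frac_ext frac_ext_is_monoid_morphism.

Lemma frac_extension : {J : {rmorphism F -> E} | forall a, J (tofrac a) = phi a}.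
Proof.
exists (frac_ext : {rmorphism F -> E}) => a.
rewrite -[LHS]/(frac_ext (tofrac a)).
by rewrite (@extE _ a 1) ?oner_neq0 // ?rmorph1 ?mulr1 ?divr1.
Qed.
End Extension.

Section ExtendDerivation.
Variable delta : R -> F.
Hypothesis deltaD : {morph delta : a b / a + b}.
Hypothesis deltaM : forall a b, delta (a * b) = delta a * tofrac b + tofrac a * delta b.

(** For f = a / b, the quotient rule in the form (delta a - f delta b) / b, which
    involves a single division and is visibly independent of the fraction chosen. *)
Definition frac_deriv_fun (f : F) : F :=
  (delta (numer f) - f * delta (denom f)) / tofrac (denom f).

Let extE f a b : b != 0 -> tofrac a = f * tofrac b ->
  frac_deriv_fun f = (delta a - f * delta b) / tofrac b.
Proof.
move=> b0 fE; apply/eqP; rewrite /frac_deriv_fun eqr_div ?tofrac_neq0 ?denom_neq0 //.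
have : delta (numer f * b) = delta (a * denom f).
  congr delta; apply/eqP; rewrite -tofrac_eq !rmorphM /= numer_denom fE.
  by rewrite mulrAC.
rewrite !deltaM numer_denom fE => rel; apply/eqP.
transitivity ((delta (numer f) * tofrac b + f * tofrac (denom f) * delta b)
   - f * tofrac b * delta (denom f) - f * tofrac (denom f) * delta b).
  by ring.
by rewrite rel; ring.
Qed.

Let dD : {morph frac_deriv_fun : f g / f + g}.
Proof.
move=> f g; rewrite (@extE _ (numer f * denom g + numer g * denom f) (denom f * denom g)).
- have nf := numer_denom f; have ng := numer_denom g.
  have df := tofrac_neq0 (denom_neq0 f); have dg := tofrac_neq0 (denom_neq0 g).
  rewrite deltaD !deltaM rmorphM /= /frac_deriv_fun nf ng.
  move: (delta (numer f)) (delta (numer g)) (delta (denom f)) (delta (denom g)).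
  move: (tofrac (denom f)) (tofrac (denom g)) df dg => df dg df0 dg0 a a' c c'.
  exact: quotient_rule_add.
- by rewrite mulf_neq0 ?denom_neq0.
- by rewrite rmorphD !rmorphM /= !numer_denom; ring.
Qed.

Let dM f g : frac_deriv_fun (f * g) = frac_deriv_fun f * g + f * frac_deriv_fun g.
Proof.
rewrite (@extE _ (numer f * numer g) (denom f * denom g)).
- have nf := numer_denom f; have ng := numer_denom g.
  have df := tofrac_neq0 (denom_neq0 f); have dg := tofrac_neq0 (denom_neq0 g).
  rewrite !deltaM rmorphM /= /frac_deriv_fun nf ng.
  move: (delta (numer f)) (delta (numer g)) (delta (denom f)) (delta (denom g)).
  move: (tofrac (denom f)) (tofrac (denom g)) df dg => df dg df0 dg0 a a' c c'.
  exact: quotient_rule_mul.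
- by rewrite mulf_neq0 ?denom_neq0.
- by rewrite !rmorphM /= !numer_denom; ring.
Qed.

Definition frac_deriv : derivation F := Derivation dD dM.

Lemma frac_derivE f :
  frac_deriv f = (delta (numer f) - f * delta (denom f)) / tofrac (denom f).
Proof. by []. Qed.

Lemma frac_deriv_tofrac a : frac_deriv (tofrac a) = delta a.
Proof.
have delta1 : delta 1 = 0.
  by apply: (addrI (delta 1)); rewrite addr0 -[in RHS](mulr1 1) deltaM tofrac1 mulr1 mul1r.
by rewrite /= (@extE _ a 1) ?oner_neq0 // tofrac1 ?mulr1 ?delta1 // mulr0 subr0 divr1.
Qed.
End ExtendDerivation.
End Fractions.

(** * Derivations of a field of rational functions *)

Section FunctionFieldDerivations.
Variables (K : fieldType) (d : nat).
Local Notation F := (funfield K d).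

(** The derivations over K form a space of dimension d, spanned by the partial
    derivatives, and the r conditions D (g i) = 0 are linear. *)
Lemma exists_derivation (r : nat) (g : 'I_r -> F) : (r < d)%N ->
  exists D : derivation F, [/\ forall i, g i \in constants D,
    forall c, ffconst d c \in constants D & exists x, D x != 0].
Proof.
move=> rd.
pose M : 'M[F]_(d, r) := \matrix_(j, i)
  ((tofrac (numer (g i))^`M(j) - g i * tofrac (denom (g i))^`M(j)) / tofrac (denom (g i))).
have [a aM a0] : exists2 a : 'rV_d, a *m M = 0 & a != 0.
  have : kermx M != 0.
    by rewrite -mxrank_eq0 mxrank_ker subn_eq0 -ltnNge (leq_ltn_trans (rank_leq_col M)).
  by case/rowV0Pn => v /sub_kermxP vM v0; exists v.
have [delta deltaE] : exists delta : {mpoly K[d]} -> F,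
    forall P, delta P = \sum_j a 0 j * tofrac P^`M(j) by eexists.
have deltaD : {morph delta : P Q / P + Q}.
  move=> P Q; rewrite !deltaE -big_split; apply: eq_bigr => j _.
  by rewrite mderivD rmorphD mulrDr.
have deltaM P Q : delta (P * Q) = delta P * tofrac Q + tofrac P * delta Q.
  rewrite !deltaE mulr_suml mulr_sumr -big_split; apply: eq_bigr => j _ /=.
  by rewrite mderivM rmorphD !rmorphM /=; ring.
have deltaC c : delta c%:MP = 0.
  by rewrite deltaE big1 // => j _; rewrite mderivC rmorph0 mulr0.
have deltaX j : delta 'X_j = a 0 j.
  rewrite deltaE (bigD1 j) //= big1 => [|i ij].
    rewrite mderivX mnm1E eqxx addr0 scale1r.
    have -> : (U_(j) - U_(j) = 0)%MM by apply/mnmP => i; rewrite mnmBE subnn mnm0E.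
    by rewrite mpolyX0 tofrac1 mulr1.
  by rewrite mderivX mnm1E eq_sym (negPf ij) scale0r rmorph0 mulr0.
exists (frac_deriv deltaD deltaM); split=> [i|c|].
- apply/constantsP; have /matrixP/(_ 0 i) := aM; rewrite !mxE => rel.
  rewrite frac_derivE -[RHS]rel !deltaE mulr_sumr -sumrB mulr_suml.
  by apply: eq_bigr => j _; rewrite mxE; ring.
- by apply/constantsP; rewrite /ffconst frac_deriv_tofrac.
- have [j aj] : exists j, a 0 j != 0.
    apply/existsP; apply: contraNT a0 => /existsPn a_eq0.
    by apply/eqP/rowP => j; rewrite mxE; apply/eqP; have := a_eq0 j; rewrite negbK.
  by exists (tofrac 'X_j); rewrite frac_deriv_tofrac deltaX.
Qed.

Lemma funfield_char0 : (forall n, n.+1%:R != 0 :> K) -> forall n, n.+1%:R != 0 :> F.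
Proof.
move=> char0 n; rewrite -(rmorph_nat (@tofrac {mpoly K[d]})) tofrac_eq0.
by rewrite -mpolyC_nat mpolyC_eq0.
Qed.
End FunctionFieldDerivations.

(** * Polynomial maps *)

Section PolynomialMaps.
Variable K : fieldType.

Lemma mpoly_rmorph_ext n (R : nzRingType) (f g : {rmorphism {mpoly K[n]} -> R}) :
  (forall c, f c%:MP = g c%:MP) -> (forall i, f 'X_i = g 'X_i) -> f =1 g.
Proof.
move=> fgC fgX P; rewrite (mpolyE P) !rmorph_sum; apply: eq_bigr => m _.
rewrite -mul_mpolyC !rmorphM fgC mpolyXE_id !rmorph_prod; congr (_ * _).
by apply: eq_bigr => i _; rewrite !rmorphXn fgX.
Qed.

Lemma comp_mpolyXt a b (F : polymap K a b) i : 'X_i \mPo F = tnth F i.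
Proof. by rewrite comp_mpolyXU -tnth_nth. Qed.

Lemma tnth_pm_comp a b c (G : polymap K b c) (F : polymap K a b) i :
  tnth (pm_comp G F) i = tnth G i \mPo F.
Proof. exact: tnth_mktuple. Qed.

Lemma comp_mpolyA a b c (G : polymap K b c) (F : polymap K a b) P :
  (P \mPo G) \mPo F = P \mPo pm_comp G F.
Proof.
pose f : {rmorphism {mpoly K[c]} -> {mpoly K[a]}} := comp_mpoly F \o comp_mpoly G.
pose g : {rmorphism {mpoly K[c]} -> {mpoly K[a]}} := comp_mpoly (pm_comp G F).
apply: (@mpoly_rmorph_ext _ _ f g) => [e|i] /=; first by rewrite !comp_mpolyC.
by rewrite !comp_mpolyXt tnth_pm_comp.
Qed.

Lemma pm_compA a b c d (H : polymap K c d) (G : polymap K b c) (F : polymap K a b) :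
  pm_comp (pm_comp H G) F = pm_comp H (pm_comp G F).
Proof. by apply: eq_from_tnth => i; rewrite !tnth_pm_comp comp_mpolyA. Qed.

Lemma pm_comp_idl a b (F : polymap K a b) : pm_comp (pm_id K b) F = F.
Proof. by apply: eq_from_tnth => i; rewrite tnth_pm_comp tnth_mktuple comp_mpolyXt. Qed.

Lemma comp_pm_id a P : P \mPo pm_id K a = P.
Proof. exact: comp_mpoly_id. Qed.

Definition pm_proj (a s : nat) : polymap K (a + s) a := [tuple 'X_(lshift s l) | l < a].

Lemma comp_pm_proj_inj a s : injective (comp_mpoly (pm_proj a s)).
Proof.
pose sec : polymap K a (a + s) :=
  [tuple if split k is inl i then 'X_i else 0 | k < a + s].
apply: (can_inj (g := comp_mpoly sec)) => P; rewrite comp_mpolyA.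
rewrite (_ : pm_comp _ _ = pm_id K a) ?comp_pm_id //; apply: eq_from_tnth => i.
rewrite tnth_pm_comp !tnth_mktuple comp_mpolyXt tnth_mktuple.
by case: split_ordP => [j /lshift_inj ->|j /eqP] //; rewrite eq_lrshift.
Qed.

Lemma tnth_pm_stab_l a b s (F : polymap K a b) i :
  tnth (pm_stab s F) (lshift s i) = tnth F i \mPo pm_proj a s.
Proof.
rewrite tnth_mktuple; case: split_ordP => [j /lshift_inj <- //|j /eqP].
by rewrite eq_lrshift.
Qed.

Lemma tnth_pm_stab_r a b s (F : polymap K a b) j :
  tnth (pm_stab s F) (rshift b j) = 'X_(rshift a j).
Proof.
rewrite tnth_mktuple; case: split_ordP => [i /eqP|i /rshift_inj <- //].
by rewrite eq_rlshift.
Qed.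

Hypothesis char0 : forall n, n.+1%:R != 0 :> K.

(** Induction on the number of variables: for fixed values of the first n
    variables, a univariate polynomial with infinitely many roots is zero. *)
Lemma mpoly_vanishing n (P : {mpoly K[n]}) : (forall v, P.@[v] = 0) -> P = 0.
Proof.
have poly_vanishing (Q : {poly K}) : (forall c, Q.[c] = 0) -> Q = 0.
  move=> Q0; apply/eqP; apply/negPn/negP => Qn0.
  have inj : injective (fun i : nat => i%:R : K).
    move=> i j; wlog ij : i j / (i <= j)%N => [th|].
      by case/orP: (leq_total i j) => ij E; [apply: th | apply/esym/th].
    move=> /eqP; rewrite eq_sym -subr_eq0 -natrB // => /eqP E.
    case ji : (j - i)%N E => [|e] E; last by have := char0 e; rewrite E eqxx.
    by apply/eqP; rewrite eqn_leq ij -subn_eq0 ji.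
  have := @max_poly_roots _ Q [seq i%:R | i <- iota 0 (size Q)] Qn0.
  rewrite size_map size_iota ltnn => H; apply: (notF (H _ _)).
    by apply/allP => _ /mapP[i _ ->]; apply/eqP.
  by rewrite map_inj_uniq ?iota_uniq.
elim: n P => [|n IH] P P0.
  have PE : P = (P@_0)%:MP.
    rewrite [LHS]mpolyE; apply/mpolyP => m; rewrite -mpolyE mcoeffC.
    by have -> : m = 0%MM; [apply/mnmP; case | rewrite eqxx mulr1].
  have := P0 (fun=> 0); rewrite PE; move: (P@_0) => c; rewrite mevalC => ->.
  exact: mpolyC0.
have muniX i : muni 'X_i = match split (cast_ord (esym (addn1 n)) i) with
    | inl j => ('X_j)%:P | inr _ => 'X end :> {poly {mpoly K[n]}}.
  by rewrite /muni mmapX mmap1U.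
have muni_inj : muni P = 0 -> P = 0.
  pose back : {rmorphism {mpoly K[n.+1]} -> {mpoly K[n.+1]}} :=
    horner_eval 'X_ord_max \o map_poly (@mwiden n K) \o @muni n K.
  suff backE : back =1 idfun.
    by move=> P_0; rewrite -[LHS]backE /= P_0 map_poly0 /horner_eval horner0.
  apply: (@mpoly_rmorph_ext _ _ back idfun) => [c|i] /=; rewrite /horner_eval.
    by rewrite muniC map_polyC hornerC /= mwidenC.
  rewrite muniX; case: splitP => j ij.
    rewrite map_polyC hornerC /= mwidenX mnmwiden1; congr 'X_(_).
    exact: val_inj.
  rewrite map_polyX hornerX; congr 'X_(_); apply: val_inj.
  by move: ij; rewrite (ord1 j) /= addn0.
apply: muni_inj; apply/polyP => i; rewrite coef0; apply: IH => v.
suff ev0 : map_poly (meval v) (muni P) = 0 by rewrite -coef_map /= ev0 coef0.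
apply: poly_vanishing => c.
pose v' i := match split (cast_ord (esym (addn1 n)) i) with inl j => v j | inr _ => c end.
rewrite -[RHS](P0 v').
pose ev : {rmorphism {mpoly K[n.+1]} -> K} :=
  horner_eval c \o map_poly (meval v) \o @muni n K.
apply: (@mpoly_rmorph_ext _ _ ev (meval v')) => [a|j] /=; rewrite /horner_eval.
  by rewrite muniC map_polyC hornerC /= !mevalC.
rewrite muniX mevalXU /v'; case: split => u; first by rewrite map_polyC hornerC /= mevalXU.
by rewrite map_polyX hornerX.
Qed.

End PolynomialMaps.

(** * The field generated by the components of a map *)

Local Notation ffield K a := (funfield K a : fieldType).

Lemma mpoly_image_mem (K E : fieldType) n (theta : {rmorphism {mpoly K[n]} -> E})
    (S : divringClosed E) :
  (forall c, theta c%:MP \in S) -> (forall i, theta 'X_i \in S) -> forall P, theta P \in S.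
Proof.
move=> SC SX P; rewrite (mpolyE P) rmorph_sum rpred_sum // => m _.
rewrite -mul_mpolyC rmorphM rpredM // mpolyXE_id rmorph_prod rpred_prod // => i _.
by rewrite rmorphXn rpredX.
Qed.

Section Pullback.
Variables (K : fieldType) (a b : nat).
Implicit Type F : polymap K a b.

Definition pm_pull F : {rmorphism {mpoly K[b]} -> funfield K a} :=
  @tofrac {mpoly K[a]} \o comp_mpoly F.

Lemma pm_pullE F P : pm_pull F P = tofrac (P \mPo F).
Proof. by []. Qed.

Lemma pm_pullC F c : pm_pull F c%:MP = ffconst a c.
Proof. by rewrite pm_pullE comp_mpolyC. Qed.

Lemma pm_pullX F i : pm_pull F 'X_i = tofrac (tnth F i).
Proof. by rewrite pm_pullE comp_mpolyXt. Qed.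

Definition pullback F : {pred funfield K a} := fun f => `[< pullback_field F f >].

Lemma pullbackP F f : reflect (pullback_field F f) (f \in pullback F).
Proof. exact: asboolP. Qed.

Lemma mem_pullback F P : pm_pull F P \in pullback F.
Proof.
by apply/pullbackP; exists P, 1; rewrite comp_mpoly1 oner_neq0 tofrac1 divr1.
Qed.

Lemma pullback_divring_closed F : divring_closed (pullback F).
Proof.
have N0 (Q : {mpoly K[b]}) : Q \mPo F != 0 -> tofrac (Q \mPo F) != 0 by rewrite tofrac_eq0.
split=> [|f g /pullbackP[P [Q [Q0 ->]]] /pullbackP[P' [Q' [Q'0 ->]]]
  |f g /pullbackP[P [Q [Q0 ->]]] /pullbackP[P' [Q' [Q'0 ->]]]].
- by rewrite -(rmorph1 (pm_pull F)) mem_pullback.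
- apply/pullbackP; exists (P * Q' - P' * Q), (Q * Q'); split.
    by rewrite rmorphM mulf_neq0.
  by rewrite -!pm_pullE rmorphB !rmorphM -[- (_ / _)]mulNr addf_div ?N0 // mulNr.
- have [P'0|P'0] := eqVneq (P' \mPo F) 0.
    by rewrite P'0 tofrac0 mul0r invr0 mulr0 -(rmorph0 (pm_pull F)) mem_pullback.
  apply/pullbackP; exists (P * Q'), (Q * P'); split; first by rewrite rmorphM mulf_neq0.
  by rewrite -!pm_pullE !rmorphM invf_div mulf_div.
Qed.

HB.instance Definition _ F :=
  GRing.isDivringClosed.Build (ffield K a) (pullback F) (pullback_divring_closed F).

Lemma pullback_sub F (S : divringClosed (ffield K a)) :
  (forall c, ffconst a c \in S) -> (forall i, tofrac (tnth F i) \in S) ->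
  {subset pullback F <= S}.
Proof.
move=> SC SF; have S_pull P : pm_pull F P \in S.
  apply: (mpoly_image_mem (theta := pm_pull F)) => [c|i].
    by rewrite pm_pullC; exact: SC.
  by rewrite pm_pullX; exact: SF.
by move=> _ /pullbackP[P [Q [_ ->]]]; apply: rpred_div; exact: S_pull.
Qed.
End Pullback.

Lemma funfield_mem (K : fieldType) d (S : divringClosed (ffield K d)) :
  (forall c, ffconst d c \in S) -> (forall i, tofrac 'X_i \in S) ->
  forall f, f \in S.
Proof.
move=> SC SX f; have := denom_neq0 f; rewrite -tofrac_eq0 => d0.
rewrite -[f](mulfK d0) -numer_denom rpred_div //;
  apply: (mpoly_image_mem (theta := @tofrac {mpoly K[d]})) => //.
Qed.

(** The coordinates of the source are polynomials in the components of an
    automorphism. *)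
Lemma funfield_mem_iso (K : fieldType) d e (alpha : polymap K d e)
    (S : divringClosed (ffield K d)) :
  pm_iso alpha -> (forall c, ffconst d c \in S) ->
  (forall i, tofrac (tnth alpha i) \in S) -> forall f, f \in S.
Proof.
move=> [alpha' [alphaK _]] SC Salpha; apply: funfield_mem => // i.
have -> : 'X_i = tnth alpha' i \mPo alpha.
  by rewrite -tnth_pm_comp alphaK tnth_mktuple.
apply: (@pullback_sub _ _ _ alpha S SC Salpha).
exact: (mem_pullback alpha (tnth alpha' i)).
Qed.

(** * Weighted lifts after stabilization *)

(** The automorphism [alpha] of the source carries the function field of A^3 into
    E by the embedding [J], and its last s components are the extra
    coordinates [u]. *)
Section StabilizedLift.
Variables (K : fieldType) (N s d : nat) (G : polymap K 3 3).
Variable (alpha : polymap K d (3 + s)).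
Hypothesis char0 : forall n, n.+1%:R != 0 :> K.
Hypothesis N1 : (1 < N)%N.
Hypothesis ds : d = (3 + s)%N.
Hypothesis alpha_iso : pm_iso alpha.
Hypothesis G_lift : weighted_lift N G.
Let Psi := pm_comp (pm_stab s G) alpha.
Let E : fieldType := funfield K d.

Let alpha3 : polymap K d 3 := pm_comp (pm_proj K 3 s) alpha.

Let tnth_alpha3 i : tnth alpha3 i = tnth alpha (lshift s i).
Proof. by rewrite tnth_pm_comp tnth_mktuple comp_mpolyXt. Qed.

Let pull_alpha3_inj : injective (pm_pull alpha3).
Proof.
move=> P Q /eqP; rewrite !pm_pullE tofrac_eq => /eqP PQ.
apply: (@comp_pm_proj_inj K 3 s); case: alpha_iso => alpha' [_ alpha'K].
have := congr1 (comp_mpoly alpha') PQ.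
by rewrite -!comp_mpolyA !(comp_mpolyA alpha) alpha'K !comp_pm_id.
Qed.

Let J : {rmorphism funfield K 3 -> E} := sval (frac_extension pull_alpha3_inj).

Let J_tofrac P : J (tofrac P) = tofrac (P \mPo alpha3).
Proof. exact: (svalP (frac_extension pull_alpha3_inj)). Qed.

Let J_const c : J (ffconst 3 c) = ffconst d c.
Proof. by rewrite /ffconst J_tofrac comp_mpolyC. Qed.

Let Psi_l i : tofrac (tnth Psi (lshift s i)) = J (tofrac (tnth G i)).
Proof. by rewrite J_tofrac tnth_pm_comp tnth_pm_stab_l comp_mpolyA. Qed.

Let Psi_r i : tnth Psi (rshift 3 i) = tnth alpha (rshift 3 i).
Proof. by rewrite tnth_pm_comp tnth_pm_stab_r comp_mpolyXt. Qed.

Let A := J (tofrac (tnth G 0)).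
Let B := J (tofrac (tnth G 1)).
Let C := J (tofrac (tnth G 2)).
Let u (i : 'I_s) : E := tofrac (tnth alpha (rshift 3 i)).

Let G_mem (S : divringClosed E) : A \in S -> B \in S -> C \in S ->
  forall i, J (tofrac (tnth G i)) \in S.
Proof.
move=> SA SB SC [[|[|[|//]]] lt3].
- by rewrite (_ : Ordinal lt3 = 0) //; apply: val_inj.
- by rewrite (_ : Ordinal lt3 = 1) //; apply: val_inj.
- by rewrite (_ : Ordinal lt3 = 2) //; apply: val_inj.
Qed.

Let gen_mem (w : funfield K 3) (S : divringClosed E) : generated_by (pullback_field G) w ->
  (forall c, ffconst d c \in S) -> A \in S -> B \in S -> C \in S ->
  (forall i, u i \in S) -> J w \in S -> forall f, f \in S.
Proof.
move=> gen Sc SA SB SC Su Sw.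
have SG : forall f, pullback_field G f -> J f \in S.
  move=> _ [P [Q [_ ->]]]; rewrite fmorph_div -!pm_pullE.
  pose th : {rmorphism {mpoly K[3]} -> E} := J \o pm_pull G.
  have th_mem R : th R \in S.
    apply: (mpoly_image_mem (theta := th)) => [c|i].
      have -> : th c%:MP = ffconst d c by rewrite -J_const -(pm_pullC G).
      exact: Sc.
    have -> : th 'X_i = J (tofrac (tnth G i)) by rewrite -(pm_pullX G).
    exact: G_mem.
  by rewrite rpred_div ?(th_mem P) ?(th_mem Q).
have SJ f : J f \in S.
  have [P [Q [SP SQ _ ->]]] := gen f.
  rewrite fmorph_div -!horner_map /=.
  by rewrite rpred_div ?rpred_horner //; apply/polyOverP => i; rewrite coef_map SG.
apply: funfield_mem_iso alpha_iso _ _ => // i.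
case: (split_ordP i) => j ->; last exact: Su.
rewrite -tnth_alpha3 -comp_mpolyXt -J_tofrac; exact: SJ.
Qed.

Let kappa : {rmorphism K -> E} := @tofrac {mpoly K[d]} \o @mpolyC d K.

Let kill (x y : E) : exists D : derivation E, [/\ x \in constants D, y \in constants D,
  forall i, u i \in constants D, forall c, ffconst d c \in constants D & exists f, D f != 0].
Proof.
have [g [gx gy gu]] : exists g : 'I_(2 + s) -> E,
    [/\ g (lshift s 0) = x, g (lshift s 1) = y & forall i, g (rshift 2 i) = u i].
  exists (fun i => match split i with inl j => if j == 0 then x else y | inr j => u j end).
  split=> [||i]; rewrite ?(unsplitK (inl _)) ?(unsplitK (inr _)) //.
have [|D [Dg Dc D0]] := @exists_derivation K d _ g; first by rewrite ds.
exists D; split=> [|||//|//].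
- rewrite -gx; exact: Dg.
- rewrite -gy; exact: Dg.
- move=> i; rewrite -gu; exact: Dg.
Qed.

Let Echar0 := @funfield_char0 K d char0.

Let consts : {pred E} := fun x => `[< exists e, x = ffconst d e >].

Let constsP (S : divringClosed E) : (forall e, ffconst d e \in S) -> {subset consts <= S}.
Proof. by move=> Sc _ /asboolP[e ->]; exact: Sc. Qed.

Let mem_consts e : ffconst d e \in consts.
Proof. by apply/asboolP; exists e. Qed.

Theorem stabilized_lift_primitive : exists (w : E) (P P1 : {poly E}),
  [/\ P \is a polyOver (pullback Psi), P = ('X - w%:P) * P1, irreducible_poly P1,
      w \notin pullback Psi & size P = N.+1].
Proof.
case: G_lift => w0 [H [c [sH c0 gen [_ _ root_w0 _]]]].
set w := J w0; pose HE := map_poly kappa H.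
have sHE : size HE = N.+1 by rewrite size_map_poly.
have kc0 : kappa c != 0 by rewrite fmorph_eq0.
have rootw : root (weighted_poly HE A B C (kappa c)) w.
  have HJ : J (map_poly (@ffconst K 3) H).[w0] = HE.[w].
    rewrite -horner_map -/w; congr _.[_]; apply/polyP => i.
    rewrite coef_map coef_map_id0 ?coef_map; first exact: J_const.
    by rewrite /ffconst mpolyC0 tofrac0.
  move/eqP: root_w0; rewrite !hornerD hornerN hornerZ hornerX hornerC => /(congr1 J).
  rewrite rmorphD rmorphB rmorph0 HJ !rmorphM -/w -/A -/B -/C J_const => rel.
  by apply/rootP; rewrite horner_weighted_poly -[RHS]rel.
have HEK0 i : HE`_i \in consts by rewrite coef_map; exact: mem_consts.
have kill' x y : exists D : derivation E, [/\ x \in constants D, y \in constants D,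
    forall i, u i \in constants D, {subset consts <= constants D} & exists f, D f != 0].
  have [D [Dx Dy Du Dc D0]] := kill x y; exists D.
  by split; [exact: Dx | exact: Dy | exact: Du
    | exact: (constsP (S := constants D) Dc) | exact: D0].
have kG i : J (tofrac (tnth G i)) \in pullback Psi.
  by rewrite -Psi_l -pm_pullX mem_pullback.
have kc : {subset consts <= pullback Psi}.
  by apply: constsP => e; rewrite -(pm_pullC Psi) mem_pullback.
have gen' (S : divringClosed E) : {subset consts <= S} -> A \in S -> B \in S -> C \in S ->
    (forall i, u i \in S) -> w \in S -> forall f, f \in S.
  by move=> Sc; apply: (gen_mem gen) => e; apply: Sc; exact: mem_consts.
have k_sub (S : divringClosed E) : {subset consts <= S} -> A \in S -> B \in S -> C \in S ->
    (forall i, u i \in S) -> {subset pullback Psi <= S}.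
  move=> Sc SA SB SC Su; apply: pullback_sub => [e|i]; first by apply: Sc; exact: mem_consts.
  case: (split_ordP i) => j ->; first by rewrite Psi_l; exact: G_mem.
  by rewrite Psi_r; exact: Su.
have sHE2 : (2 < size HE)%N by rewrite sHE.
have [P [P1 PP1]] := weighted_poly_primitive Echar0 sHE2 HEK0 (mem_consts c) kc0 rootw
  kill' gen' k_sub kc (And3 (kG 0) (kG 1) (kG 2)).
by exists w, P, P1; rewrite -sHE.
Qed.
End StabilizedLift.

(** * Maps whose fibres are described by Phi *)

Lemma coordXE (K : fieldType) n (i : 'I_n) : coordX K n i = 'X_i.
Proof. by rewrite /coordX valK. Qed.

Lemma Phi_fiber (K : fieldType) n :
  Phi K n = fiber_poly n (2^-1)%:MP (coordX K n 0) (coordX K n 1) (fun j => coordX K n j.-1).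
Proof. by rewrite /Phi /fiber_poly /fiber_bracket mul_mpolyC. Qed.

Lemma lamE (K : fieldType) n j : lam K n j = (Phi K n)`_j.
Proof. by rewrite /lam; case: eqP => [->|]. Qed.

Lemma half_add_half (K : fieldType) : 2 != 0 :> K -> 2^-1 + 2^-1 = 1 :> K.
Proof. by move=> two0; field. Qed.

(** The common situation of K_n and of its descents: [F] is read on the source
    A^a through [phi], a closed embedding into A^n with left inverse [psi], and
    the coefficients of Phi restricted to A^a are polynomials in the components
    of [F]. *)
Section StableInequivalence.
Variables (K : fieldType) (n a b : nat) (G : polymap K 3 3).
Variables (F : polymap K a b) (phi : polymap K a n) (psi : polymap K n a).
Hypothesis char0 : forall i, i.+1%:R != 0 :> K.
Hypothesis n3 : (3 < n)%N.
Hypothesis G_lift : weighted_lift (n * (n - 2)) G.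
Hypothesis psiK : pm_comp psi phi = pm_id K a.
Hypothesis x_neq0 : coordX K n 0 \mPo phi != 0.
Hypothesis p_neq0 : (1 + coordX K n 0 * coordX K n 1) \mPo phi != 0.
Hypothesis Phi_F : forall j, exists Q, (Phi K n)`_j \mPo phi = Q \mPo F.

Theorem not_stably_equivalent_weighted_lift : ~ stably_equivalent F G.
Proof.
move=> [s [s' [ad _ [alpha [beta [alpha_iso [beta' [betaK _]] eqFG]]]]]].
have N1 : (1 < n * (n - 2))%N.
  by have [n_lt _] := fiber_degree_bounds n3; apply: ltn_trans n_lt; apply: ltn_trans n3.
have [w [P [P1 [kP PE irr wNk sP]]]] := stabilized_lift_primitive char0 N1 ad alpha_iso G_lift.
set Psi := pm_comp (pm_stab s' G) alpha in kP wNk.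
have stab_mem i : tofrac (tnth (pm_stab s F) i) \in pullback Psi.
  have -> : pm_stab s F = pm_comp beta' Psi.
    by rewrite /Psi -eqFG -pm_compA betaK pm_comp_idl.
  by rewrite tnth_pm_comp; exact: mem_pullback.
have const_mem c : ffconst (a + s) c \in pullback Psi.
  by rewrite -(pm_pullC Psi); exact: mem_pullback.
pose proj := pm_proj K a s; pose theta := pm_pull (pm_comp phi proj).
have thetaE Q : theta Q = tofrac ((Q \mPo phi) \mPo proj).
  by rewrite comp_mpolyA.
have theta_neq0 Q : Q \mPo phi != 0 -> theta Q != 0.
  by rewrite thetaE tofrac_eq0 -(inj_eq (@comp_pm_proj_inj K a s)) rmorph0.
have kPhi : map_poly theta (Phi K n) \is a polyOver (pullback Psi).
  apply/polyOverP => j; rewrite coef_map -[X in X \in _]/(theta (Phi K n)`_j) thetaE.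
  have [Q ->] := Phi_F j.
  rewrite comp_mpolyA -pm_pullE.
  apply: (mpoly_image_mem (theta := pm_pull (pm_comp F proj))) => [c|i].
    by rewrite pm_pullC; exact: const_mem.
  by rewrite pm_pullX tnth_pm_comp -tnth_pm_stab_l; exact: stab_mem.
rewrite Phi_fiber map_fiber_poly in kPhi.
have half : theta (2^-1)%:MP + theta (2^-1)%:MP = 1.
  by rewrite -rmorphD -mpolyCD half_add_half ?rmorph1 //; exact: char0.
apply: (fiber_not_primitive n3 half (theta_neq0 _ x_neq0) _ kPhi kP PE irr wNk sP).
  by rewrite -rmorphM -(rmorph1 theta) -rmorphD; exact: theta_neq0.
move=> S kS Sx Sy Sz.
have SX (i : 'I_n) : theta 'X_i \in S.
  rewrite -coordXE; case: i => -[|[|i]] lti //; exact: (Sz i.+3).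
have Sc c : ffconst (a + s) c \in S by apply: kS; exact: const_mem.
apply: (funfield_mem Sc) => i; case: (split_ordP i) => j ->; last first.
  by rewrite -(tnth_pm_stab_r F); apply: kS; exact: stab_mem.
have -> : tofrac 'X_(lshift s j) = theta (tnth psi j).
  by rewrite thetaE -tnth_pm_comp psiK tnth_mktuple comp_mpolyXt tnth_mktuple.
apply: (mpoly_image_mem (theta := theta)) => // c.
by rewrite /theta pm_pullC; exact: Sc.
Qed.
End StableInequivalence.

Lemma fiber_eval (K : fieldType) n (x y : K) (z : nat -> K) (P : 'I_n -> K) :
  (3 < n)%N ->
  (forall i : 'I_n, P i = if i == 0 :> nat then x else if i == 1%N :> nat then y else z i.+1) ->
  map_poly (meval P) (Phi K n) = fiber_poly n 2^-1 x y z.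
Proof.
move=> n3 PE; rewrite Phi_fiber map_fiber_poly /= mevalC.
have n0 : (0 < n)%N by apply: ltn_trans n3.
have n1 : (1 < n)%N by apply: ltn_trans n3.
rewrite (coordXE K (Ordinal n0)) (coordXE K (Ordinal n1)) !mevalXU !PE /=.
apply: eq_fiber_poly => // -[|j] // /andP[j2 jn] /=.
rewrite (coordXE K (Ordinal jn)) mevalXU PE /=.
by case: j j2 jn => [|[|j]].
Qed.

(** * K_n and its coordinate descents *)

Section CoordinateDescent.
Variables (K : fieldType) (n k : nat) (v : nat -> K) (phi : polymap K (n - k).+1 n).
Hypothesis char0 : forall i, i.+1%:R != 0 :> K.
Hypothesis n3 : (3 < n)%N.
Hypothesis kn : (1 <= k <= n - 2)%N.
Hypothesis phi_param : parametrizes (@locus K n k v) phi.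

Let eq_mpoly a (P Q : {mpoly K[a]}) : (forall t, P.@[t] = Q.@[t]) -> P = Q.
Proof.
move=> PQ; apply/eqP; rewrite -subr_eq0; apply/eqP; apply: (mpoly_vanishing char0) => t.
by rewrite mevalB PQ subrr.
Qed.

Lemma descent_lam j : (2 <= j <= k)%N -> lam K n j \mPo phi = (v j)%:MP.
Proof.
move=> jk; apply: eq_mpoly => t; rewrite comp_mpoly_meval mevalC.
exact: (phi_param.1 t).
Qed.

Lemma descent_section : exists psi, pm_comp psi phi = pm_id K (n - k).+1.
Proof.
have [_ [psi [psiK _]]] := phi_param; exists psi; apply: eq_from_tnth => i.
rewrite tnth_pm_comp tnth_mktuple; apply: eq_mpoly => t.
by rewrite comp_mpoly_meval mevalXU -[RHS](psiK t i).
Qed.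

Lemma descent_neq0 (Q : {mpoly K[n]}) (P : 'I_n -> K) :
  locus k v P -> Q.@[P] != 0 -> Q \mPo phi != 0.
Proof.
have [_ [psi [_ phiK]]] := phi_param.
move=> VP; apply: contraNneq => Q0.
have := comp_mpoly_meval (pm_eval psi P) Q phi; rewrite Q0 meval0 => ->.
by apply/eqP/meval_eq => i; exact: esym (phiK P VP i).
Qed.

Let point x y (z : nat -> K) (i : 'I_n) :=
  if i == 0 :> nat then x else if i == 1%N :> nat then y else z i.+1.

Let locus_point x y z :
  (forall j, (2 <= j <= n - 2)%N -> (fiber_poly n 2^-1 x y z)`_j = v j) ->
  locus k v (point x y z).
Proof.
move=> zv j jk; rewrite lamE -coef_map (@fiber_eval _ _ x y z) // zv //.
by case/andP: jk => -> /leq_trans -> //; case/andP: kn.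
Qed.

Let n0 : (0 < n)%N. Proof. exact: ltn_trans n3. Qed.
Let n1 : (1 < n)%N. Proof. exact: ltn_trans n3. Qed.

Lemma descent_x_neq0 : coordX K n 0 \mPo phi != 0.
Proof.
have [z zv] := fiber_point_p0 v n3.
apply: (descent_neq0 (locus_point zv)).
by rewrite (coordXE K (Ordinal n0)) mevalXU oner_neq0.
Qed.

Lemma descent_p_neq0 : (1 + coordX K n 0 * coordX K n 1) \mPo phi != 0.
Proof.
have [y [z zv]] := fiber_point_x0 v char0 n3.
apply: (descent_neq0 (locus_point zv)).
rewrite mevalD mevalM meval1 (coordXE K (Ordinal n0)) mevalXU /point /= mul0r addr0.
exact: oner_neq0.
Qed.

(** On the locus the coefficients of the prefix are constants, and the remaining
    ones are the components of the descent. *)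
Lemma descent_coef j : exists Q, (Phi K n)`_j \mPo phi = Q \mPo pm_comp (free_coefs K n k) phi.
Proof.
have [k1 k2] := andP kn.
case: j => [|[|j]].
- exists (- 'X_ord_max).
  rewrite comp_mpolyN comp_mpolyXt tnth_pm_comp tnth_mktuple /= ltnn.
  by rewrite /coefA0 comp_mpolyN opprK.
- exists 1; rewrite Phi_fiber coef1_fiber_poly ?comp_mpoly1 //.
  by rewrite -mpolyCD half_add_half //; exact: char0.
have [jk|kj] := leqP j.+2 k.
  by exists (v j.+2)%:MP; rewrite -lamE descent_lam // comp_mpolyC.
have [jn|nj] := leqP j.+2 n; last first.
  exists 0; rewrite comp_mpoly0 (_ : (Phi K n)`_j.+2 = 0) ?comp_mpoly0 //.
  by apply: nth_default; rewrite Phi_fiber (leq_trans (size_fiber_poly _ _ _ _ n3)).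
have i_lt : (j.+2 - k.+1 < n - k)%N by lia.
exists 'X_(widen_ord (leqnSn _) (Ordinal i_lt)).
by rewrite comp_mpolyXt tnth_pm_comp tnth_mktuple /= i_lt subnK // lamE.
Qed.
End CoordinateDescent.

Lemma Kmap_coef (K : fieldType) n j : (forall i, i.+1%:R != 0 :> K) -> (3 < n)%N ->
  exists Q, (Phi K n)`_j \mPo pm_id K n = Q \mPo Kmap K n.
Proof.
move=> char0 n3; rewrite comp_pm_id; case: j => [|[|[|j]]].
- have lt_n : (n.-1 < n)%N by lia.
  exists (- 'X_(Ordinal lt_n)); rewrite comp_mpolyN comp_mpolyXt tnth_mktuple /=.
  have -> : (n.-1 < n - 2)%N = false by lia.
  have -> : (n.-1 == n - 2)%N = false by lia.
  by rewrite /coefA0 opprK.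
- exists 1; rewrite Phi_fiber coef1_fiber_poly ?comp_mpoly1 //.
  by rewrite -mpolyCD half_add_half //; exact: char0.
- have lt_n : (n - 2 < n)%N by lia.
  by exists 'X_(Ordinal lt_n); rewrite comp_mpolyXt tnth_mktuple /= ltnn eqxx.
have [jn|nj] := leqP j.+3 n; last first.
  exists 0; rewrite comp_mpoly0; apply: nth_default.
  by rewrite Phi_fiber (leq_trans (size_fiber_poly _ _ _ _ n3)).
have lt_n : (j < n)%N by lia.
exists 'X_(Ordinal lt_n); rewrite comp_mpolyXt tnth_mktuple /=.
have -> : (j < n - 2)%N by lia.
by rewrite /coefC addn3.
Qed.

Theorem corollary1p4 (R : realType) (n m : nat)
    (hn : (4 <= n)%N) (hm : m = (n - 2)%N)
    (G : polymap (complex R) 3 3) (hG : weighted_lift (n * m) G) :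
  ~ stably_equivalent (Kmap (complex R) n) G /\
  (forall (k : nat) (v : nat -> complex R)
      (F : polymap (complex R) (n - k).+1 (n - k).+1),
    (1 <= k <= n - 2)%N -> is_descent n k v F -> ~ stably_equivalent F G).
Proof.
subst m; have char0 i : i.+1%:R != 0 :> complex R by rewrite Num.Theory.pnatr_eq0.
split=> [|k v F kn [phi phi_param ->]].
- have n0 : (0 < n)%N by apply: ltn_trans hn.
  have n1 : (1 < n)%N by apply: ltn_trans hn.
  apply: (not_stably_equivalent_weighted_lift char0 hn hG (phi := pm_id _ n) (psi := pm_id _ n)).
  + exact: pm_comp_idl.
  + rewrite comp_pm_id (coordXE _ (Ordinal n0)); apply/eqP => /(congr1 (meval (fun=> 1))).
    by rewrite mevalXU meval0 => /eqP; rewrite oner_eq0.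
  + rewrite comp_pm_id; apply/eqP => /(congr1 (meval (fun=> 1))).
    rewrite (coordXE _ (Ordinal n0)) (coordXE _ (Ordinal n1)) mevalD mevalM meval1 !mevalXU.
    by rewrite meval0 mulr1 => /eqP; rewrite (negPf (char0 1%N)).
  + by move=> j; exact: Kmap_coef.
- have [psi psiK] := descent_section char0 phi_param.
  apply: (not_stably_equivalent_weighted_lift char0 hn hG psiK).
  + exact: descent_x_neq0 kn phi_param.
  + exact: descent_p_neq0 kn phi_param.
  + by move=> j; exact: descent_coef char0 hn kn phi_param j.
Qed.
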